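(* Let $\mu,\nu$ be probability measures on $\mathbb{R}^d$ with finite first moments, i.e. $\int |x|\,\mu(dx)<\infty$ and $\int |y|\,\nu(dy)<\infty$. Then \[ \inf_{f\in \mathcal{C}^1(\mathbb{R}^d)}\left(\int f\,d\nu - \int f\,d\mu \right)=\inf_{\rho\in \mathcal{P}^1(\mathbb{R}^d)} \left( C(\nu,\rho)-C(\mu,\rho)\right), \] where $\mathcal{P}^1(\mathbb{R}^d):=\{\rho\in \mathcal{P}(\mathbb{R}^d): \mathrm{supp}(\rho)\subseteq B_1(0)\}$ and $\mathcal{C}^1(\mathbb{R}^d):=\{f:\mathbb{R}^d\to \mathbb{R} \text{ convex and } 1\text{-Lipschitz}\}$.
   Context: $\mathcal{P}(\mathbb{R}^d)$ is the set of Borel probability measures on $\mathbb{R}^d$; $B_1(0)$ is the closed/open Euclidean unit ball around $0$ (support contained in the unit ball). For probability measures $\alpha,\rho$ on $\mathbb{R}^d$, $\Pi(\alpha,\rho)$ denotes the set of couplings (probability measures on $\mathbb{R}^d\times\mathbb{R}^d$ with marginals $\alpha$ and $\rho$), and $C(\alpha,\rho):=\sup_{\pi\in\Pi(\alpha,\rho)}\int \langle x,y\rangle\,\pi(dx,dy)$, with $\langle\cdot,\cdot\rangle$ the Euclidean scalar product. *)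

(* Defs.v *)
From HB Require Import structures.
From mathcomp Require Import all_boot all_order all_algebra.
From mathcomp Require Import all_classical all_reals all_analysis.
Set Implicit Arguments. Unset Strict Implicit. Unset Printing Implicit Defensive.
Import Order.TTheory GRing.Theory Num.Theory.
Import numFieldNormedType.Exports.
Local Open Scope classical_set_scope.
Local Open Scope ring_scope.

Definition Rd (R : realType) (n : nat) := g_sigma_algebraType (@open 'rV[R]_n).

Definition dotp (R : realType) (n : nat) (x y : 'rV[R]_n) : R :=
  \sum_(i < n) x ord0 i * y ord0 i.
Definition enorm (R : realType) (n : nat) (x : 'rV[R]_n) : R := Num.sqrt (dotp x x).

Definition finite_first_moment (R : realType) (n : nat)
  (mu : probability (Rd R n) R) : Prop :=
  (\int[mu]_x (enorm (x : 'rV[R]_n))%:E < +oo)%E.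

Definition supp (R : realType) (n : nat) (rho : probability (Rd R n) R) : set 'rV[R]_n :=
  [set x | forall r : R, 0 < r -> (0 < rho [set y : Rd R n | (enorm (y - x) < r)%R])%E].

Definition P1 (R : realType) (n : nat) (rho : probability (Rd R n) R) : Prop :=
  supp rho `<=` [set x | enorm x <= 1].

Definition coupling (R : realType) (n : nat) (alpha rho : probability (Rd R n) R)
  (pi : probability (Rd R n * Rd R n)%type R) : Prop :=
  (forall A : set (Rd R n), measurable A -> pi (A `*` setT) = alpha A) /\
  (forall A : set (Rd R n), measurable A -> pi (setT `*` A) = rho A).

Definition Ccost (R : realType) (n : nat) (alpha rho : probability (Rd R n) R) : \bar R :=
  ereal_sup [set v | exists pi : probability (Rd R n * Rd R n)%type R,
    coupling alpha rho pi /\ v = (\int[pi]_z (dotp (z.1 : 'rV[R]_n) z.2)%:E)%E].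

Definition convex_1lip (R : realType) (n : nat) (f : 'rV[R]_n -> R) : Prop :=
  (forall (x y : 'rV[R]_n) (t : R), 0 <= t -> t <= 1 ->
     f (t *: x + (1 - t) *: y) <= t * f x + (1 - t) * f y) /\
  (forall x y : 'rV[R]_n, `|f x - f y| <= enorm (x - y)).

(* Main.v *)
(* Write [C] for [Ccost]. If [f] is convex and 1-Lipschitz with conjugate [f*], then
   [C(nu, rho) <= int f dnu + int f* drho] for every [rho], while for [rho] the image
   of [mu] under a (sub)gradient of [f] the same bound for [mu] is attained. Taking
   the gradient of the Moreau envelope of [f], which is continuous and takes values
   in the unit ball, avoids any measurable selection and loses only [lam].

   Conversely, given [rho] on the unit ball, cut the ball into small pieces [B j] of
   positive mass [b j] around points [Y j]. The dual functional
   [int max_j (<x, Y j> - psi j) dnu(x) + sum_j b j * psi j] is smoothed by a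
   quadratic penalty so that its minimiser [psi] yields weights [w j x] with
   [sum_j w j x = 1] and [int w j dnu = b j] exactly. These weights are the density
   [sum_j w j x / b j * 1_(B j) y] of a coupling of [nu] and [rho], concentrated where
   [<x, Y j>] is at least [pot x + psi j]; hence the convex 1-Lipschitz potential
   [pot] is almost optimal for [C(nu, rho)] and admissible for [C(mu, rho)]. *)

Require Import Defs.
From HB Require Import structures.
From mathcomp Require Import all_boot all_order all_algebra.
From mathcomp Require Import all_classical all_reals all_analysis.
From mathcomp Require Import measurable_realfun ring lra.
Import Order.TTheory GRing.Theory Num.Theory.
Import numFieldNormedType.Exports.
Local Open Scope classical_set_scope.
Local Open Scope ring_scope.

Set Implicit Arguments.
Unset Strict Implicit.
Unset Printing Implicit Defensive.

(** * Euclidean geometry of row vectors *)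

Section euclidean.
Context {R : realType} {n : nat}.
Implicit Types (x y z : 'rV[R]_n) (a : R).

Lemma dotpC x y : dotp x y = dotp y x.
Proof. by apply: eq_bigr => i _; rewrite mulrC. Qed.

Lemma dotpDl x y z : dotp (x + y) z = dotp x z + dotp y z.
Proof. by rewrite -big_split; apply: eq_bigr => i _; rewrite mxE mulrDl. Qed.

Lemma dotpZl a x y : dotp (a *: x) y = a * dotp x y.
Proof. by rewrite mulr_sumr; apply: eq_bigr => i _; rewrite mxE mulrA. Qed.

Lemma dotpNl x y : dotp (- x) y = - dotp x y.
Proof. by rewrite -scaleN1r dotpZl mulN1r. Qed.

Lemma dotpDr x y z : dotp z (x + y) = dotp z x + dotp z y.
Proof. by rewrite dotpC dotpDl !(dotpC z). Qed.

Lemma dotpZr a x y : dotp x (a *: y) = a * dotp x y.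
Proof. by rewrite dotpC dotpZl dotpC. Qed.

Lemma dotpNr x y : dotp x (- y) = - dotp x y.
Proof. by rewrite dotpC dotpNl dotpC. Qed.

Definition dotpE := (dotpDl, dotpDr, dotpNl, dotpNr, dotpZl, dotpZr).

Lemma dotpxx_ge0 x : 0 <= dotp x x.
Proof. by apply: sumr_ge0 => i _; rewrite -expr2 sqr_ge0. Qed.

Lemma enorm_ge0 x : 0 <= enorm x.
Proof. exact: sqrtr_ge0. Qed.

Lemma sqr_enorm x : enorm x ^+ 2 = dotp x x.
Proof. by rewrite sqr_sqrtr ?dotpxx_ge0. Qed.

Lemma dotp0l y : dotp 0 y = 0.
Proof. by apply: big1 => i _; rewrite mxE mul0r. Qed.

Lemma enorm0 : enorm (0 : 'rV[R]_n) = 0.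
Proof. by rewrite /enorm dotp0l sqrtr0. Qed.

Lemma coord_le_enorm x i : `|x ord0 i| <= enorm x.
Proof.
rewrite -ler_sqr ?nnegrE ?enorm_ge0// sqr_enorm real_normK ?num_real//.
rewrite /dotp (bigD1 i)//= -expr2 lerDl.
by apply: sumr_ge0 => j _; rewrite -expr2 sqr_ge0.
Qed.

Lemma enorm_eq0 x : enorm x = 0 -> x = 0.
Proof.
move=> x0; apply/rowP => i; rewrite mxE; apply/eqP.
by rewrite -normr_le0 -x0 coord_le_enorm.
Qed.

(** Cauchy-Schwarz: the square of [enorm y *: x - enorm x *: y] is nonnegative and equals
    [2 * enorm x * enorm y] times the gap. *)
Lemma le_dotp_enorm x y : dotp x y <= enorm x * enorm y.
Proof.
have [y0|y0] := eqVneq (enorm y) 0.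
  by rewrite y0 mulr0 (enorm_eq0 y0) dotpC dotp0l.
have y_gt0 : 0 < enorm y by rewrite lt_neqAle eq_sym y0 enorm_ge0.
have := dotpxx_ge0 (enorm y *: x - (enorm x) *: y).
rewrite !dotpE -!sqr_enorm (dotpC y x) => h.
have [x0|x0] := eqVneq (enorm x) 0.
  by rewrite x0 mul0r (enorm_eq0 x0) dotp0l.
have x_gt0 : 0 < enorm x by rewrite lt_neqAle eq_sym x0 enorm_ge0.
have {}h : 0 <= (2 * enorm x * enorm y) * (enorm x * enorm y - dotp x y).
  by rewrite (le_trans h)// le_eqVlt; apply/orP; left; apply/eqP; ring.
by move: h; rewrite pmulr_rge0 ?subr_ge0// !mulr_gt0.
Qed.

Lemma enormN x : enorm (- x) = enorm x.
Proof. by rewrite /enorm !dotpE opprK. Qed.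

Lemma enormB x y : enorm (x - y) = enorm (y - x).
Proof. by rewrite -enormN opprB. Qed.

Lemma normr_dotp_le x y : `|dotp x y| <= enorm x * enorm y.
Proof.
by rewrite ler_norml le_dotp_enorm lerNl -dotpNl -(enormN x) le_dotp_enorm.
Qed.

Lemma enormZ a x : enorm (a *: x) = `|a| * enorm x.
Proof.
by rewrite /enorm !dotpE mulrA -expr2 sqrtrM ?sqr_ge0// sqrtr_sqr.
Qed.

Lemma enormD x y : enorm (x + y) <= enorm x + enorm y.
Proof.
rewrite -ler_sqr ?nnegrE ?addr_ge0 ?enorm_ge0// sqrrD !sqr_enorm !dotpE.
rewrite (dotpC y x); have := le_dotp_enorm x y; lra.
Qed.

Lemma enorm_le_sum x : enorm x <= \sum_i `|x ord0 i|.
Proof.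
rewrite [X in enorm X](_ : x = \sum_i x ord0 i *: delta_mx 0 i); last first.
  exact: row_sum_delta.
elim/big_ind2: _ => [|u a v b uv vb|i _]; first by rewrite enorm0.
  by rewrite (le_trans (enormD _ _))// lerD.
rewrite enormZ -[leRHS]mulr1 ler_wpM2l// /enorm /dotp (bigD1 i)//= big1 => [|j ji].
  by rewrite !mxE !eqxx mulr1 addr0 sqrtr1.
by rewrite !mxE (negbTE ji) andbF mulr0.
Qed.

Lemma enorm_le_norm x : enorm x <= n%:R * `|x|.
Proof.
rewrite (le_trans (enorm_le_sum x))// mulr_natl.
rewrite [leRHS](_ : _ = \sum_(i < n) `|x|); last by rewrite sumr_const card_ord.
rewrite ler_sum// => i _.
rewrite [leRHS]mx_normrE; exact: (le_bigmax _ (fun ij => `|x ij.1 ij.2|) (ord0, i)).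
Qed.

Lemma lip_enorm x y : `|enorm x - enorm y| <= enorm (x - y).
Proof.
have := enormD (x - y) y; have := enormD (y - x) x; rewrite !subrK (enormB y x).
by rewrite ler_norml => *; apply/andP; split; lra.
Qed.

Lemma lip_continuous (c : R) (f : 'rV[R]_n -> R) :
  (forall x y, `|f x - f y| <= c * enorm (x - y)) -> continuous f.
Proof.
move=> lf x; apply/(@cvgrPdist_le _ _ _ (nbhs x)) => e e0.
(* The topology of row vectors comes from the maximum norm, so the Euclidean Lipschitz constant
   picks up a factor [n]; the summand 1 keeps [k] positive when [c] or [n] vanishes. *)
pose k := `|c| * n%:R + 1.
have k0 : 0 < k by rewrite ltr_wpDl// mulr_ge0.
near=> y.
rewrite (le_trans (lf _ _))//.
rewrite (@le_trans _ _ (k * `|x - y|))//; last first.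
  rewrite mulrC -ler_pdivlMr//; near: y.
  by apply: cvgr_dist_le => //; rewrite divr_gt0.
rewrite (@le_trans _ _ (`|c| * enorm (x - y)))//.
  by rewrite ler_wpM2r ?ler_norm ?enorm_ge0.
rewrite /k mulrDl -mulrA (le_trans (ler_wpM2l _ (enorm_le_norm _)))//.
by rewrite lerDl mul1r.
Unshelve. all: by end_near.
Qed.

Lemma norm_le_enorm x : `|x| <= enorm x.
Proof.
rewrite [leLHS]mx_normrE; apply: bigmax_le => [|[i j] _]; first exact: enorm_ge0.
by rewrite /= (ord1 i); exact: coord_le_enorm.
Qed.

Lemma lip_continuousT (c : R) (f : 'rV[R]_n -> 'rV[R]_n) :
  (forall x y, enorm (f x - f y) <= c * enorm (x - y)) -> continuous f.
Proof.
move=> lf x; apply/(@cvgrPdist_le _ _ _ (nbhs x)) => e e0.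
have cg : continuous (fun y => enorm (f x - f y)).
  apply: (@lip_continuous c) => y z; rewrite (le_trans _ (lf y z))//.
  rewrite (le_trans (lip_enorm _ _))// opprB [_ + (f z - _)]addrC addrA subrK.
  by rewrite enormB.
have /(@cvgrPdist_le _ _ _ (nbhs x))/(_ _ e0) he := cg x.
near=> y; rewrite (le_trans (norm_le_enorm _))//.
have : `|enorm (f x - f x) - enorm (f x - f y)| <= e.
  by near: y.
by rewrite subrr enorm0 sub0r normrN ger0_norm ?enorm_ge0.
Unshelve. all: by end_near.
Qed.

Lemma continuous_dotpr y : continuous (fun x => dotp x y).
Proof.
apply: (@lip_continuous (enorm y)) => x x'.
by rewrite -dotpNl -dotpDl mulrC normr_dotp_le.
Qed.

End euclidean.

(** * Borel measurability of continuous maps *)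

Section measurability.
Context {R : realType} {n : nat}.

Lemma open_Rd_measurable (U : set 'rV[R]_n) : open U -> measurable (U : set (Rd R n)).
Proof. by move=> oU; exact: sub_sigma_algebra. Qed.

Lemma continuous_Rd_measurable (f : 'rV[R]_n -> R) :
  continuous f -> measurable_fun setT (f : Rd R n -> R).
Proof.
move=> /continuousP cf.
apply: (measurability _ (RGenOpens.measurableE R)) => _ [_ [a [b ->]] <-].
by rewrite setTI; apply: open_Rd_measurable; exact/cf/interval_open.
Qed.

Lemma lip_Rd_measurable (c : R) (f : 'rV[R]_n -> R) :
  (forall x y, `|f x - f y| <= c * enorm (x - y)) ->
  measurable_fun setT (f : Rd R n -> R).
Proof. by move=> lf; apply: continuous_Rd_measurable; exact: lip_continuous lf. Qed.

Lemma measurable_enorm : measurable_fun setT (@enorm R n : Rd R n -> R).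
Proof.
by apply: (@lip_Rd_measurable 1) => x y; rewrite mul1r lip_enorm.
Qed.

Lemma measurable_coord i :
  measurable_fun setT (fun x : Rd R n => (x : 'rV[R]_n) ord0 i).
Proof.
apply: (@lip_Rd_measurable 1) => x y; rewrite mul1r.
by have := coord_le_enorm (x - y) i; rewrite !mxE.
Qed.

Lemma measurable_dotp :
  measurable_fun setT (fun z : Rd R n * Rd R n => dotp (z.1 : 'rV[R]_n) z.2).
Proof.
apply: measurable_sum => i; apply: measurable_funM.
  exact: (measurableT_comp (measurable_coord i)).
exact: (measurableT_comp (measurable_coord i)).
Qed.

Lemma continuous_Rd_measurableT (T : 'rV[R]_n -> 'rV[R]_n) :
  continuous T -> measurable_fun setT (T : Rd R n -> Rd R n).
Proof.
move=> /continuousP cT.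
apply: measurability => [|_ [U oU <-]]; first reflexivity.
by rewrite setTI; apply: open_Rd_measurable; exact: cT.
Qed.

End measurability.

(** * Couplings and weak duality *)

Section integral_complements.
Context {R : realType}.

Lemma EFin_Rintegral d (T : measurableType d) (mu : {measure set T -> \bar R})
    (D : set T) (f : T -> R) :
  measurable D -> mu.-integrable D (EFin \o f) ->
  (\int[mu]_(x in D) (f x)%:E)%E = (\int[mu]_(x in D) f x)%:E.
Proof. by move=> mD fi; rewrite /Rintegral fineK//; exact: integrable_fin_num. Qed.

Lemma le_Rintegral_null d (T : measurableType d) (mu : {measure set T -> \bar R})
    (E : set T) (f g : T -> R) :
  measurable E -> mu (~` E) = 0%E ->
  mu.-integrable setT (EFin \o f) -> mu.-integrable setT (EFin \o g) ->
  (forall x, E x -> f x <= g x) -> \int[mu]_x f x <= \int[mu]_x g x.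
Proof.
move=> mE E0 fi gi fg; rewrite /Rintegral.
rewrite (negligible_integral (measurableC mE) measurableT fi E0).
rewrite (negligible_integral (measurableC mE) measurableT gi E0).
rewrite setTD setCK; apply: le_Rintegral => //.
- exact: integrableS fi.
- exact: integrableS gi.
Qed.

Section change_of_variables.
Context d1 d2 (X : measurableType d1) (Y : measurableType d2).
Variables (mu : {measure set X -> \bar R}) (nu : {measure set Y -> \bar R}).
Variables (phi : X -> Y) (mphi : measurable_fun setT phi).
Hypothesis mu_nu : forall A, measurable A -> mu (phi @^-1` A) = nu A.
Variable f : Y -> R.
Hypothesis fi : nu.-integrable setT (EFin \o f).

Let phi_mfun : {mfun X >-> Y} :=
  HB.pack phi (isMeasurableFun.Build _ _ _ _ phi mphi).

(** Stating [mu_nu] as an equality on measurable sets lets the change of variables serve both the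
    marginals of a coupling and images under a map. *)
Lemma integrable_image : mu.-integrable setT (EFin \o (f \o phi)).
Proof.
have /integrableP[mf foo] := fi; apply/integrableP; split.
  exact: (measurableT_comp mf).
move: foo; rewrite -(@eq_measure_integral _ _ _ _ nu (pushforward mu phi_mfun)).
  rewrite ge0_integral_pushforward//; exact: measurableT_comp.
by move=> A mA _; exact: mu_nu.
Qed.

Lemma Rintegral_image : \int[mu]_x f (phi x) = \int[nu]_y f y.
Proof.
have /integrableP[mf foo] := fi; rewrite /Rintegral; congr fine.
rewrite -(@eq_measure_integral _ _ _ _ nu (pushforward mu phi_mfun)); last first.
  by move=> A mA _; exact: mu_nu.
by rewrite [RHS]integral_pushforward//; exact: integrable_image.
Qed.

End change_of_variables.
End integral_complements.

Lemma integrableD_EFin d (T : measurableType d) (R : realType)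
    (mu : {measure set T -> \bar R}) (f g : T -> R) :
  mu.-integrable setT (EFin \o f) -> mu.-integrable setT (EFin \o g) ->
  mu.-integrable setT (EFin \o (fun x => f x + g x)).
Proof.
move=> fi gi; rewrite (_ : _ \o _ = (EFin \o f) \+ (EFin \o g))//.
exact: integrableD.
Qed.

Lemma integrableZl_EFin d (T : measurableType d) (R : realType)
    (mu : {measure set T -> \bar R}) (c : R) (f : T -> R) :
  mu.-integrable setT (EFin \o f) ->
  mu.-integrable setT (EFin \o (fun x => c * f x)).
Proof.
move=> fi; rewrite (_ : _ \o _ = (fun x => c%:E * (EFin \o f) x)%E)//.
exact: integrableZl.
Qed.

Lemma Rintegral_prob_cst d (T : measurableType d) (R : realType)
    (mu : probability T R) (c : R) : \int[mu]_(x in setT) c = c.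
Proof.
rewrite Rintegral_cst// -[RHS]mulr1; congr (_ * _).
by rewrite [X in fine X](_ : _ = 1%E)//; exact: probability_setT.
Qed.

Section first_moment.
Context {R : realType} {n : nat}.

Lemma finite_first_moment_integrable (mu : probability (Rd R n) R) :
  finite_first_moment mu -> mu.-integrable setT (EFin \o @enorm R n).
Proof.
move=> h; apply/integrableP; split.
  by apply/measurable_EFinP; exact: measurable_enorm.
by under eq_integral => x _ do rewrite /= ger0_norm ?enorm_ge0//.
Qed.

Lemma integrable_affine_bound d (T : measurableType d) (mu : probability T R)
    (f g : T -> R) (a : R) :
  measurable_fun setT f -> mu.-integrable setT (EFin \o g) ->
  (forall x, `|f x| <= `|g x| + a) -> mu.-integrable setT (EFin \o f).
Proof.
move=> mf gi fg.
apply: (@le_integrable _ _ _ _ _ measurableT _ (EFin \o (fun x => `|g x| + a))).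
- exact/measurable_EFinP.
- by move=> x _; rewrite /= lee_fin (le_trans (fg x))// ler_norm.
- rewrite (_ : _ \o _ = (EFin \o (Num.norm \o g)) \+ (EFin \o cst a))//.
  apply: integrableD => //; first exact: integrable_norm.
  exact: finite_measure_integrable_cst.
Qed.

Lemma lip_integrable (mu : probability (Rd R n) R) (f : 'rV[R]_n -> R) :
  finite_first_moment mu ->
  (forall x y, `|f x - f y| <= enorm (x - y)) ->
  mu.-integrable setT (EFin \o f : Rd R n -> \bar R).
Proof.
move=> mu1 lf.
apply: (integrable_affine_bound (a := `|f 0|) _
  (finite_first_moment_integrable mu1)).
  by apply: (@lip_Rd_measurable _ _ 1) => x y; rewrite mul1r.
move=> x; rewrite (ger0_norm (enorm_ge0 _)) -lerBlDr.
by rewrite (le_trans (lerB_dist _ _))// (le_trans (lf _ _))// subr0.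
Qed.

End first_moment.

Section couplings.
Context {R : realType} {n : nat}.
Implicit Types alpha rho : probability (Rd R n) R.
Implicit Types pi : probability (Rd R n * Rd R n)%type R.

Definition uball : set (Rd R n) := [set y | enorm (y : 'rV[R]_n) <= 1].

Lemma measurable_uball : measurable uball.
Proof.
rewrite (_ : uball = setT `&` (@enorm R n : Rd R n -> R) @^-1` `]-oo, 1]); last first.
  by rewrite setTI; apply/seteqP; split => x; rewrite /= in_itv.
exact: measurable_enorm.
Qed.

Section marginals.
Variables (alpha rho : probability (Rd R n) R).
Variable pi : probability (Rd R n * Rd R n)%type R.
Hypothesis cpi : coupling alpha rho pi.

Lemma coupling_fst (A : set (Rd R n)) : measurable A -> pi (fst @^-1` A) = alpha A.
Proof.
move=> mA; rewrite -(cpi.1 _ mA); congr (pi _).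
by apply/seteqP; split => -[x y]//= [].
Qed.

Lemma coupling_snd (A : set (Rd R n)) : measurable A -> pi (snd @^-1` A) = rho A.
Proof.
move=> mA; rewrite -(cpi.2 _ mA); congr (pi _).
by apply/seteqP; split => -[x y]//= [].
Qed.

Section potentials.
Variables phi psi : Rd R n -> R.
Hypothesis phii : alpha.-integrable setT (EFin \o phi).
Hypothesis psii : rho.-integrable setT (EFin \o psi).

Lemma integrable_coupling_sum :
  pi.-integrable setT (EFin \o (fun z => phi z.1 + psi z.2)).
Proof.
rewrite (_ : _ \o _ = (EFin \o (phi \o fst)) \+ (EFin \o (psi \o snd)))//.
apply: integrableD => //.
- exact: (integrable_image measurable_fst coupling_fst).
- exact: (integrable_image measurable_snd coupling_snd).
Qed.

Lemma Rintegral_coupling_sum : \int[pi]_z (phi z.1 + psi z.2) =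
  \int[alpha]_x phi x + \int[rho]_y psi y.
Proof.
rewrite RintegralD//.
- by rewrite (Rintegral_image measurable_fst coupling_fst)//
    (Rintegral_image measurable_snd coupling_snd).
- exact: (integrable_image measurable_fst coupling_fst).
- exact: (integrable_image measurable_snd coupling_snd).
Qed.

End potentials.

Hypothesis alpha1 : finite_first_moment alpha.
Hypothesis rho_uball : rho (~` uball) = 0%E.

(** The points whose second coordinate leaves [uball] are null; elsewhere Cauchy-Schwarz dominates
    the integrand by [enorm z.1], integrable by the first marginal. *)
Lemma integrable_coupling_dotp :
  pi.-integrable setT (EFin \o (fun z => dotp (z.1 : 'rV[R]_n) z.2)).
Proof.
have m2 : measurable (snd @^-1` (~` uball) : set (Rd R n * Rd R n)).
  rewrite -[X in measurable X]setTI.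
  by apply: measurable_snd => //; apply: measurableC; exact: measurable_uball.
have md : measurable_fun setT
    (EFin \o (fun z : Rd R n * Rd R n => dotp (z.1 : 'rV[R]_n) z.2)).
  by apply/measurable_EFinP; exact: measurable_dotp.
have m20 : pi (snd @^-1` (~` uball)) = 0%E.
  by rewrite coupling_snd//; apply: measurableC; exact: measurable_uball.
apply/(negligible_integrable m2 measurableT md m20).
rewrite setTD; apply: (@le_integrable _ _ _ _ _ _ _
    (EFin \o (fun z : Rd R n * Rd R n => enorm (z.1 : 'rV[R]_n)))).
- exact: measurableC.
- exact: measurable_funTS.
- move=> z /= /contrapT zb; rewrite lee_fin (ger0_norm (enorm_ge0 _)).
  by rewrite (le_trans (normr_dotp_le _ _))// ler_piMr ?enorm_ge0.
- apply: (integrableS measurableT) => //; first exact: measurableC.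
  apply: (integrable_image measurable_fst coupling_fst).
  exact: finite_first_moment_integrable.
Qed.

End marginals.

Section Ccost.
Variables (alpha rho : probability (Rd R n) R).
Hypothesis alpha1 : finite_first_moment alpha.
Hypothesis rho_uball : rho (~` uball) = 0%E.

Lemma le_Ccost pi : coupling alpha rho pi ->
  ((\int[pi]_z dotp (z.1 : 'rV[R]_n) z.2)%:E <= Ccost alpha rho)%E.
Proof.
move=> cpi; apply: ereal_sup_ubound; exists pi; split => //.
by rewrite EFin_Rintegral//; exact: (integrable_coupling_dotp cpi).
Qed.

Lemma Ccost_le (c : R) : (forall pi, coupling alpha rho pi ->
    \int[pi]_z dotp (z.1 : 'rV[R]_n) z.2 <= c) ->
  (Ccost alpha rho <= c%:E)%E.
Proof.
move=> h; apply: ge_ereal_sup => _ [pi [cpi ->]].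
by rewrite EFin_Rintegral ?lee_fin ?h//; exact: (integrable_coupling_dotp cpi).
Qed.

(** Weak duality: integrate the pointwise bound against any coupling. The bound is asked only on a
    set [E] of full [rho]-measure, because later it is available only on the union of the cells, or
    where a conjugate is finite. *)
Lemma Ccost_le_potentials (E : set (Rd R n)) (phi psi : Rd R n -> R) :
  measurable E -> rho (~` E) = 0%E ->
  alpha.-integrable setT (EFin \o phi) -> rho.-integrable setT (EFin \o psi) ->
  (forall x y, E y -> dotp (x : 'rV[R]_n) y <= phi x + psi y) ->
  (Ccost alpha rho <= (\int[alpha]_x phi x + \int[rho]_y psi y)%:E)%E.
Proof.
move=> mE E0 phii psii dle; apply: Ccost_le => pi cpi.
rewrite -(Rintegral_coupling_sum cpi)//.
apply: (@le_Rintegral_null _ _ _ _ (snd @^-1` E)).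
- by rewrite -[X in measurable X]setTI; exact: measurable_snd.
- exact: (etrans (coupling_snd cpi (measurableC mE)) E0).
- exact: (integrable_coupling_dotp cpi).
- exact: (integrable_coupling_sum cpi).
- by move=> z; exact: dle.
Qed.

End Ccost.

End couplings.
Arguments uball {R n}.

(** * Measures on the unit ball *)

Lemma negligible_bigcup_countType (R : realType) d (T : measurableType d)
    (mu : {measure set T -> \bar R}) (I : countType) (F : I -> set T) :
  (forall i, mu.-negligible (F i)) -> mu.-negligible (\bigcup_i F i).
Proof.
move=> F0; pose G k := if unpickle k is Some i then F i else set0.
have G0 k : mu.-negligible (G k).
  by rewrite /G; case: unpickle => [i//|]; exact: negligible_set0.
apply: (negligibleS _ (negligible_bigcup G0)) => x [i _ Fx].
by exists (pickle i) => //; rewrite /G pickleK.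
Qed.

Section support.
Context {R : realType} {n : nat}.
Implicit Type rho : probability (Rd R n) R.

Lemma measurable_eball (x : 'rV[R]_n) (r : R) :
  measurable ([set y | enorm (y - x) < r] : set (Rd R n)).
Proof.
rewrite [X in measurable X](_ : _ =
  setT `&` ((fun y => enorm (y - x)) : Rd R n -> R) @^-1` `]-oo, r[); last first.
  by rewrite setTI; apply/seteqP; split => y; rewrite /= in_itv.
have mf : measurable_fun setT ((fun y => enorm (y - x)) : Rd R n -> R).
  apply: (@lip_Rd_measurable _ _ 1) => y z; rewrite mul1r.
  by rewrite (le_trans (lip_enorm _ _))// opprB addrA subrK.
exact: mf.
Qed.

Lemma rat_approx (x : 'rV[R]_n) (e : R) : 0 < e ->
  exists q : 'rV[rat]_n, enorm (map_mx ratr q - x) < e.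
Proof.
move=> e0; pose d := e / n.+1%:R.
have d0 : 0 < d by rewrite divr_gt0.
have h i : exists q : rat, `|ratr q - x ord0 i| < d.
  have : x ord0 i - d < x ord0 i + d by rewrite ltrD2l gtrN.
  move=> /rat_in_itvoo[q]; rewrite in_itv/= => qd; exists q.
  by rewrite ltr_distl.
have [q qP] := choice h; exists (\row_i q i).
rewrite (le_lt_trans (enorm_le_sum _))// (@le_lt_trans _ _ (d *+ n))//.
  rewrite [leRHS](_ : _ = \sum_(i < n) d); last by rewrite sumr_const card_ord.
  by rewrite ler_sum// => i _; rewrite !mxE ltW.
by rewrite /d -mulr_natr mulrAC ltr_pdivrMr// ltr_pM2l// ltr_nat.
Qed.

(** Balls with rational centres and radii [1/(k+1)] are countably many, and those of mass zero cover
    every point outside [supp rho], hence the complement of the unit ball. *)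
Lemma P1_uball rho : P1 rho -> rho (~` uball) = 0%E.
Proof.
move=> rho1.
pose ball_ (p : 'rV[rat]_n * nat) : set (Rd R n) :=
  [set y | enorm (y - map_mx ratr p.1) < p.2.+1%:R^-1].
pose F p := if rho (ball_ p) == 0%E then ball_ p else set0.
have F0 p : rho.-negligible (F p).
  rewrite /F; case: ifPn => [/eqP p0|_]; last exact: negligible_set0.
  by exists (ball_ p); split => //; exact: measurable_eball.
have mb : measurable (~` uball : set (Rd R n)).
  by apply: measurableC; exact: measurable_uball.
apply/(measure_negligible mb).
apply: (negligibleS _ (negligible_bigcup_countType F0)) => x xb.
have : ~ supp rho x by move=> /rho1.
move=> /existsNP[r /not_implyP[r0]] /negP; rewrite -leNgt measure_le0 => /eqP rho0.
(* With both its radius and the distance of its centre to [x] below [r / 2], the rational ball lies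
   inside the null ball of radius [r] around [x]. *)
have r2 : 0 < r / 2 by lra.
have [k kr] : exists k, k.+1%:R^-1 < r / 2.
  have [k _ /(_ k (leqnn k))] := near_infty_natSinv_lt (PosNum r2).
  by exists k.
have [q qx] := @rat_approx x k.+1%:R^-1 (ltac:(by [])).
exists (q, k) => //; rewrite /F.
have -> : rho (ball_ (q, k)) = 0%E.
  apply/eqP; rewrite -measure_le0 -rho0; apply: le_measure; rewrite ?inE.
  - exact: measurable_eball.
  - exact: measurable_eball.
  - move=> y /=; rewrite /ball_ /= => yq.
    have := enormD (y - map_mx ratr q) (map_mx ratr q - x).
    rewrite addrA subrK => /le_lt_trans; apply; apply: lt_trans (ltrD yq qx) _.
    by rewrite [ltRHS]splitr ltrD.
by rewrite eqxx /ball_/= enormB.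
Qed.

(** If [enorm x > 1], the ball of radius [enorm x - 1] around [x] misses [uball] and is therefore
    null. *)
Lemma uball_P1 rho : rho (~` uball) = 0%E -> P1 rho.
Proof.
move=> rho0 x xs; rewrite /= leNgt; apply/negP => x1.
have := xs (enorm x - 1); rewrite subr_gt0 => /(_ x1); apply/negP.
rewrite -leNgt -rho0; apply: le_measure; rewrite ?inE.
- exact: measurable_eball.
- by apply: measurableC; exact: measurable_uball.
- move=> y /= yx /= y1.
  have := enormD (x - y) y; rewrite subrK enormB; move: yx y1.
  rewrite /uball/=; lra.
Qed.

End support.

(** * Partition of the unit ball into small cells *)

Section small_partition.
Context {R : realType} {n : nat}.
Implicit Type rho : probability (Rd R n) R.

(** A grid of cubes of side [1/K]: shifting by 1 puts the coordinates of the ball in [0, 2], and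
    [j i] is the integer part after scaling. It takes [2 * K + 1] values because the coordinate 1
    gives [2 * K]. *)
Let cell K (j : {ffun 'I_n -> 'I_(2 * K).+1}) : set (Rd R n) := uball `&`
  \bigcap_i [set y | (j i)%:R <= K%:R * ((y : 'rV[R]_n) ord0 i + 1) < (j i).+1%:R].

Let measurable_cell K j : measurable (@cell K j).
Proof.
apply: measurableI; first exact: measurable_uball.
apply: fin_bigcap_measurable => [|i _]; first exact: finite_finset.
have mf : measurable_fun setT (fun y : Rd R n => K%:R * ((y : 'rV[R]_n) ord0 i + 1)).
  apply: measurable_funM => //; apply: measurable_funD => //.
  exact: measurable_coord.
have := mf measurableT `[(j i)%:R, (j i).+1%:R[%classic (measurable_itv _).
by rewrite setTI.
Qed.

Let cell_inj K j j' y : @cell K j y -> cell j' y -> j = j'.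
Proof.
move=> [_ jy] [_ jy']; apply/ffunP => i; apply/val_inj.
by rewrite /= -(truncn_def (jy i I)) -(truncn_def (jy' i I)).
Qed.

Let cell_cover K y : uball y -> exists j, @cell K j y.
Proof.
move=> yb.
have yi i : 0 <= (y : 'rV[R]_n) ord0 i + 1 <= 2.
  have := le_trans (coord_le_enorm y i) yb; rewrite ler_norml.
  by move=> /andP[? ?]; apply/andP; split; lra.
have K0 i : 0 <= K%:R * ((y : 'rV[R]_n) ord0 i + 1).
  by rewrite mulr_ge0//; case/andP: (yi i).
exists [ffun i => inord (Num.truncn (K%:R * ((y : 'rV[R]_n) ord0 i + 1)))].
split => // i _ /=; rewrite ffunE inordK; first exact: truncn_itv.
rewrite truncn_lt_nat// -natr1 natrM ltr_pwDr// mulrC ler_wpM2r//.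
by case/andP: (yi i).
Qed.

Let cell_diam K j y y' : (0 < K)%N -> @cell K j y -> cell j y' ->
  enorm ((y : 'rV[R]_n) - y') <= n%:R / K%:R.
Proof.
move=> K0 [_ jy] [_ jy']; rewrite (le_trans (enorm_le_sum _))//.
rewrite mulrC [leRHS](_ : _ = \sum_(i < n) K%:R^-1); last first.
  by rewrite sumr_const card_ord mulr_natr.
apply: ler_sum => i _; have KR : 0 < K%:R :> R by rewrite ltr0n.
rewrite -(ler_pM2l KR) divff ?gt_eqF// -[X in X * _]gtr0_norm// -normrM.
have /andP[] := jy i I; have /andP[] := jy' i I; rewrite !mxE -!natr1.
by move=> *; rewrite ler_norml; apply/andP; split; lra.
Qed.

(** Only cells of positive mass are kept: the coupling density divides by [rho (B j)], and positive
    mass makes a cell nonempty, which provides [Y j]. The finitely many discarded cells are null. *)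
Lemma small_partition rho (delta : R) : rho (~` uball) = 0%E -> 0 < delta ->
  exists (m : nat) (B : 'I_m -> set (Rd R n)) (Y : 'I_m -> 'rV[R]_n),
    [/\ forall j, measurable (B j) /\ (0 < rho (B j))%E, trivIset setT B,
        rho (~` \bigcup_j B j) = 0%E,
        forall j, enorm (Y j) <= 1 &
        forall j y, B j y -> enorm (y - Y j) <= delta].
Proof.
(* [K] exceeds [n / delta], which brings the bound [n / K] on the cell diameter below [delta]. *)
move=> rho0 d0; pose K := (Num.truncn (n%:R / delta)).+1.
have Kd : n%:R / K%:R <= delta.
  rewrite ler_pdivrMr ?ltr0n// mulrC -ler_pdivrMr//.
  have nd : 0 <= n%:R / delta by rewrite divr_ge0// ltW.
  by apply: ltW; have /andP[] := truncn_itv nd.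
pose J := [pred j | (0 < rho (@cell K j))%E].
have Yex (k : 'I_#|J|) : exists y, cell (enum_val k) y.
  have := enum_valP k; rewrite inE /= => ck.
  apply/set0P/negP => /eqP c0; move: ck.
  by rewrite c0 measure0 ltxx.
have [Y YP] := choice Yex.
exists #|J|, (fun k => cell (enum_val k)), Y; split.
- by move=> k; split; [exact: measurable_cell|have := enum_valP k].
- by move=> k l _ _ [y [yk yl]]; apply: enum_val_inj; exact: cell_inj yk yl.
- have mU : measurable (\bigcup_(k : 'I_#|J|) cell (enum_val k)).
    apply: fin_bigcup_measurable => [|k _]; first exact: finite_finset.
    exact: measurable_cell.
  apply/(measure_negligible (measurableC mU)).
  pose F j := if rho (@cell K j) == 0%E then cell j else set0.
  have F0 j : rho.-negligible (F j).
    rewrite /F; case: ifPn => [/eqP p0|_]; last exact: negligible_set0.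
    by exists (cell j); split => //; exact: measurable_cell.
  have b0 : rho.-negligible (~` uball).
    by exists (~` uball); split => //; apply: measurableC; exact: measurable_uball.
  apply: (negligibleS _ (negligibleU b0 (negligible_bigcup_countType F0))) => y yU.
  have [yb|] := pselect (uball y); last by left.
  right; have [j yj] := cell_cover K yb; exists j => //; rewrite /F.
  case: ifPn => // rj; exfalso; apply: yU.
  have jJ : j \in J by rewrite inE /= lt_neqAle eq_sym rj measure_ge0.
  by exists (enum_rank_in jJ j) => //; rewrite enum_rankK_in.
- by move=> k; have [] := YP k.
- by move=> k y yk; rewrite (le_trans _ Kd)//; exact: cell_diam (YP k).
Qed.

End small_partition.

(** * A penalised maximum *)

Section penalised_maximum.
Context {R : realType} {m : nat} (eta : R).
Hypotheses (m_gt0 : (0 < m)%N) (eta_gt0 : 0 < eta).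
Implicit Types (u v : 'I_m -> R) (t c : R).

Let pos (a : R) := Num.max a 0.

Let pos_ge0 a : 0 <= pos a. Proof. by rewrite /pos le_max lexx orbT. Qed.
Let pos_ge a : a <= pos a. Proof. by rewrite /pos le_max lexx. Qed.
Let le_pos a b : a <= b -> pos a <= pos b.
Proof. by move=> ab; rewrite /pos ge_max le_max ab/= le_max lexx orbT. Qed.
Let posP a : (pos a = a /\ 0 <= a) \/ (pos a = 0 /\ a < 0).
Proof. by rewrite /pos; case: (leP 0 a) => a0; [left|right]. Qed.

(** Tangent inequality for the convex function [pos a ^+ 2], whose derivative is [2 * pos a]. *)
Let pos_sqr_tangent a b : pos a ^+ 2 + 2 * (b - a) * pos a <= pos b ^+ 2.
Proof.
have [[-> a0]|[-> a0]] := posP a; last by rewrite mulr0 addr0 expr0n/= sqr_ge0.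
have := sqr_ge0 (b - a).
have [[-> b0]|[-> b0]] := posP b; first by rewrite !expr2; lra.
have : 0 <= a * - b by rewrite mulr_ge0// oppr_ge0 ltW.
by rewrite !expr2; have := sqr_ge0 a; rewrite expr2; lra.
Qed.

Definition excess u t := \sum_j Num.max (u j - t) 0.

Lemma continuous_excess u : continuous (excess u).
Proof.
move=> t; rewrite /excess; apply: cvg_big => //=; first exact: add_continuous.
move=> j _; apply: (@continuous_max _ _ (fun t => u j - t) (fun=> 0)).
  by apply: continuousB => //; exact: cvg_cst.
exact: cvg_cst.
Qed.

(** Intermediate value theorem: the term [j0] alone makes the excess at least [eta] at [u j0 - eta],
    and the excess vanishes at an upper bound of all [u j]. *)
Lemma excess_level_exists u : exists t, excess u t = eta.
Proof.
pose j0 := Ordinal m_gt0.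
have hj j : u j <= \sum_i `|u i|.
  rewrite (bigD1 j)//= (le_trans (ler_norm _))// lerDl sumr_ge0//.
have h1 : excess u (\sum_j `|u j|) = 0.
  apply: big1 => j _; rewrite max_r// subr_le0//.
have h2 : eta <= excess u (u j0 - eta).
  rewrite /excess (bigD1 j0)//= subKr max_l ?(ltW eta_gt0)// lerDl.
  by apply: sumr_ge0 => j _; exact: pos_ge0.
have [|||t _ ut] := @IVT R (excess u) (u j0 - eta) (\sum_j `|u j|) eta.
- by rewrite lerBlDr (le_trans (hj j0))// lerDl ltW.
- by apply: continuous_subspaceT; exact: continuous_excess.
- have h3 := le_trans (ltW eta_gt0) h2.
  by rewrite h1 min_r// max_l// (ltW eta_gt0).
- by exists t.
Qed.

(* The [t] solving [excess u t = eta]; it lies between [max u - eta] and [max u]. *)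
Definition level u := xget 0 [set t | excess u t = eta].

Lemma excess_level u : excess u (level u) = eta.
Proof.
rewrite /level; case: xgetP => //.
by case: (excess_level_exists u) => t ut /(_ t).
Qed.

Lemma le_excess u v s t : (forall j, u j - s <= v j - t) -> excess u s <= excess v t.
Proof. by move=> uv; apply: ler_sum => j _; exact: le_pos. Qed.

(** Since [eta > 0], some term is positive at [level u]; that term makes the excess strictly larger
    at any smaller argument. *)
Lemma level_le u t : excess u t <= eta -> level u <= t.
Proof.
move=> ut; rewrite leNgt; apply/negP => tl.
suff : excess u (level u) < excess u t by rewrite excess_level ltNge ut.
have [j uj] : exists j, 0 < u j - level u.
  apply/not_existsP => h; have := eta_gt0; rewrite -(excess_level u).
  by rewrite /excess big1 ?ltxx// => j _; rewrite max_r// leNgt; apply/negP.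
rewrite /excess (bigD1 j)//= [ltRHS](bigD1 j)//= ltr_leD//.
  by rewrite max_l ?(ltW uj)// lt_max ltrD2l ltrN2 tl.
by apply: ler_sum => i _; apply: le_pos; rewrite lerD2l lerN2 ltW.
Qed.

Lemma level_ler u v c : (forall j, v j <= u j + c) -> level v <= level u + c.
Proof.
move=> uv; apply: level_le; rewrite -[leRHS](excess_level u).
by apply: le_excess => j; have := uv j; lra.
Qed.

(** Each term of [excess] is jointly convex in [u] and [t], so at the mixture of the two levels the
    excess of [w] is at most [eta]. *)
Lemma level_convex u v w t : 0 <= t <= 1 ->
  (forall j, w j = t * u j + (1 - t) * v j) ->
  level w <= t * level u + (1 - t) * level v.
Proof.
move=> /andP[t0 t1] wE; apply: level_le.
rewrite [leRHS](_ : _ = t * excess u (level u) + (1 - t) * excess v (level v)).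
  rewrite /excess !mulr_sumr -big_split; apply: ler_sum => j _ /=.
  rewrite wE ge_max; apply/andP; split.
    rewrite [leLHS](_ : _ = t * (u j - level u) + (1 - t) * (v j - level v));
      last by ring.
    by apply: lerD; apply: ler_wpM2l; rewrite ?subr_ge0//; exact: pos_ge.
  by apply: addr_ge0; apply: mulr_ge0; rewrite ?subr_ge0//; exact: pos_ge0.
by rewrite !excess_level; ring.
Qed.

Let pos_le_eta u j : pos (u j - level u) <= eta.
Proof.
rewrite -[leRHS](excess_level u) /excess (bigD1 j)//= lerDl.
by apply: sumr_ge0 => i _; exact: pos_ge0.
Qed.

Lemma le_level u j : u j - eta <= level u.
Proof. have := pos_le_eta u j; have := pos_ge (u j - level u); lra. Qed.

Definition weight u j := Num.max (u j - level u) 0 / eta.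

Lemma weight_ge0 u j : 0 <= weight u j.
Proof. by rewrite divr_ge0 ?(ltW eta_gt0)//; exact: pos_ge0. Qed.

Lemma weight_le1 u j : weight u j <= 1.
Proof. by rewrite ler_pdivrMr// mul1r; exact: pos_le_eta. Qed.

Lemma sum_weight u : \sum_j weight u j = 1.
Proof. by rewrite -mulr_suml -/(excess u _) excess_level divff// gt_eqF. Qed.

Lemma weight_gt0 u j : 0 < weight u j -> level u < u j.
Proof.
rewrite pmulr_lgt0 ?invr_gt0// -/(pos _).
have [[-> _]|[-> _]] := posP (u j - level u).
  by rewrite subr_gt0.
by rewrite ltxx.
Qed.

(** By convex duality this is the maximum of [\sum_j p j * u j - eta / 2 * \sum_j p j ^+ 2] over
    probability vectors [p], attained at [weight u], which is thus the gradient of [pmax] at [u]. *)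
Definition pmax u :=
  level u + (\sum_j Num.max (u j - level u) 0 ^+ 2) / (2 * eta).

(* The minimum over [t] of the right-hand side is attained at [t = level u]. *)
Lemma pmax_le u t : pmax u <= t + (\sum_j Num.max (u j - t) 0 ^+ 2) / (2 * eta).
Proof.
have e2 : 0 < 2 * eta by rewrite mulr_gt0.
set s := level u.
suff h : \sum_j Num.max (u j - s) 0 ^+ 2 + 2 * eta * (s - t) <=
    \sum_j Num.max (u j - t) 0 ^+ 2.
  rewrite /pmax -/s -(ler_pM2l e2) !mulrDr !(mulrC (2 * eta) (_ / _)).
  by rewrite !divfK ?gt_eqF//; lra.
rewrite [2 * eta * _](_ : _ = \sum_j 2 * (s - t) * Num.max (u j - s) 0); last first.
  by rewrite -mulr_sumr -/(excess u s) excess_level; ring.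
rewrite -big_split.
apply: ler_sum => j _ /=; rewrite -!/(pos _).
rewrite (le_trans _ (pos_sqr_tangent (u j - s) _))// lerD2l.
by rewrite le_eqVlt; apply/orP; left; apply/eqP; ring.
Qed.

Lemma level_le_pmax u : level u <= pmax u.
Proof.
rewrite lerDl divr_ge0 ?mulr_ge0 ?(ltW eta_gt0)// sumr_ge0// => j _.
exact: sqr_ge0.
Qed.

Lemma pmax_ler u v c : (forall j, v j <= u j + c) -> pmax v <= pmax u + c.
Proof.
move=> uv; rewrite (le_trans (pmax_le v (level u + c)))//.
rewrite addrAC lerD2r lerD2l ler_pM2r ?invr_gt0 ?mulr_gt0//.
apply: ler_sum => j _; rewrite ler_sqr ?nnegrE; [|exact: pos_ge0|exact: pos_ge0].
by apply: le_pos; have := uv j; lra.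
Qed.

(** Insert [level u] in the variational bound [pmax_le] for [v]; the squared positive part has a
    2-Lipschitz derivative, whence the quadratic remainder. The shift is by [- t] because [slack]
    subtracts [psi]. *)
Lemma pmax_descent u v j t :
  v j = u j - t -> (forall i, i != j -> v i = u i) ->
  pmax v <= pmax u - t * weight u j + t ^+ 2 / (2 * eta).
Proof.
move=> vj vi; rewrite (le_trans (pmax_le v (level u)))//.
have e2 : 0 < 2 * eta by rewrite mulr_gt0.
rewrite /pmax /weight -!addrA lerD2l -(ler_pM2l e2) !mulrDr.
rewrite ![2 * eta * (_ / (2 * eta))]mulrC !divfK ?gt_eqF//.
rewrite (_ : 2 * eta * - _ = - (2 * t * Num.max (u j - level u) 0)); last first.
  by field; rewrite gt_eqF.
rewrite (bigD1 j)//= [in leRHS](bigD1 j)//= vj.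
rewrite (eq_bigr (fun i => Num.max (u i - level u) 0 ^+ 2)); last first.
  by move=> i ij; rewrite vi.
suff : Num.max (u j - t - level u) 0 ^+ 2 <= Num.max (u j - level u) 0 ^+ 2 -
    2 * t * Num.max (u j - level u) 0 + t ^+ 2 by lra.
rewrite -!/(pos _) addrAC.
set a := u j - level u; rewrite !expr2.
have [[-> h1]|[-> h1]] := posP (a - t); have [[-> h2]|[-> h2]] := posP a.
- by lra.
- have : 0 <= (- a) * (- t - - a) by rewrite mulr_ge0//; lra.
  have : 0 <= (- t) * (- a) by rewrite mulr_ge0//; lra.
  lra.
- by have := sqr_ge0 (a - t); rewrite expr2; lra.
- by have := sqr_ge0 t; rewrite expr2; lra.
Qed.

End penalised_maximum.

(** * Almost optimal potentials for a given target *)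

Lemma quad_ineq_eq0 (R : realType) (a c : R) :
  (forall t, 0 <= t * a + c * t ^+ 2) -> a = 0.
Proof.
(* At [t = - a / k] the expression equals [- a ^+ 2 * (k - c) / k ^+ 2], so any positive [k > c]
   forces [a = 0]. *)
move=> h; pose k := `|c| + 1.
have k0 : 0 < k by rewrite ltr_wpDl.
have ck : c < k by rewrite (le_lt_trans (ler_norm c))// ltrDl.
have := h (- a / k); rewrite expr2.
rewrite (_ : _ + _ = - (a ^+ 2 * ((k - c) / (k * k)))); last first.
  by field; rewrite gt_eqF.
rewrite oppr_ge0 pmulr_lle0; last by rewrite divr_gt0 ?mulr_gt0// subr_gt0.
by move=> a0; apply/eqP; rewrite -sqrf_eq0 eq_le a0 sqr_ge0.
Qed.

(** * The smoothed semidiscrete dual problem *)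

Section semidiscrete.
Context {R : realType} {n m : nat}.
Variables (nu : probability (Rd R n) R) (Y : 'I_m -> 'rV[R]_n) (b : 'I_m -> R).
Variable eta : R.
Hypotheses (m_gt0 : (0 < m)%N) (eta_gt0 : 0 < eta).
Hypothesis nu1 : finite_first_moment nu.
Hypothesis Y1 : forall j, enorm (Y j) <= 1.
Hypotheses (b_gt0 : forall j, 0 < b j) (b1 : \sum_j b j = 1).
Implicit Type psi : 'rV[R]_m.

Definition slack psi (x : 'rV[R]_n) (j : 'I_m) := dotp x (Y j) - psi ord0 j.

(** The potential is [level] rather than [pmax]: every slack is at most [level + eta], and a slack
    of positive weight exceeds [level], so pointwise bounds hold on both sides. *)
Definition pot psi (x : 'rV[R]_n) := level eta (slack psi x).

Let slack_lip psi x x' j : slack psi x j <= slack psi x' j + enorm (x - x').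
Proof.
rewrite /slack addrAC lerD2r -lerBlDl -dotpNl -dotpDl.
by rewrite (le_trans (le_dotp_enorm _ _))// ler_piMr ?enorm_ge0.
Qed.

Lemma pot_convex_1lip psi : convex_1lip (pot psi).
Proof.
split=> [x y t t0 t1|x y].
  apply: (level_convex m_gt0 eta_gt0); first by rewrite t0.
  by move=> j; rewrite /slack !dotpE; ring.
have h1 := level_ler m_gt0 eta_gt0 (slack_lip psi x y).
have := level_ler m_gt0 eta_gt0 (slack_lip psi y x); rewrite (enormB y x) => h2.
by rewrite /pot ler_norml; apply/andP; split; lra.
Qed.

Let pmax_lip psi x y :
  `|pmax eta (slack psi x) - pmax eta (slack psi y)| <= enorm (x - y).
Proof.
have h1 := pmax_ler m_gt0 eta_gt0 (slack_lip psi x y).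
have := pmax_ler m_gt0 eta_gt0 (slack_lip psi y x); rewrite (enormB y x) => h2.
by rewrite ler_norml; apply/andP; split; lra.
Qed.

Let pmax_integrable psi :
  nu.-integrable setT (EFin \o (fun x : Rd R n => pmax eta (slack psi x))).
Proof. exact: lip_integrable. Qed.

Lemma measurable_weight psi j :
  measurable_fun setT (fun x : Rd R n => weight eta (slack psi x) j).
Proof.
apply: measurable_funM => //; apply: measurable_maxr => //.
apply: measurable_funB; last first.
  apply: (@lip_Rd_measurable _ _ 1) => x y; rewrite mul1r.
  by have [_] := pot_convex_1lip psi; apply.
apply: measurable_funB => //.
by apply: continuous_Rd_measurable; exact: continuous_dotpr.
Qed.

Lemma integrable_weight psi j :
  nu.-integrable setT (EFin \o (fun x : Rd R n => weight eta (slack psi x) j)).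
Proof.
apply: (integrable_affine_bound (g := fun=> 0) (a := 1)).
- exact: measurable_weight.
- exact: integrable0.
- by move=> x; rewrite normr0 add0r ger0_norm ?weight_ge0// weight_le1.
Qed.

Let cst_integrable (c : R) : nu.-integrable setT (EFin \o (fun _ : Rd R n => c)).
Proof. exact: finite_measure_integrable_cst. Qed.

Let dual psi := \int[nu]_x pmax eta (slack psi x) + \sum_j b j * psi ord0 j.

Let integral_pmax_ler psi psi' c :
  (forall j, psi' ord0 j <= psi ord0 j + c) ->
  \int[nu]_x pmax eta (slack psi x) <= \int[nu]_x pmax eta (slack psi' x) + c.
Proof.
move=> h; rewrite -[X in _ + X](Rintegral_prob_cst nu) -RintegralD//.
apply: le_Rintegral => //.
  by apply: integrableD_EFin => //; exact: finite_measure_integrable_cst.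
move=> x _; apply: (pmax_ler m_gt0 eta_gt0) => j.
by rewrite /slack; have := h j; lra.
Qed.

Let dual_ler psi psi' c : (forall j, `|psi ord0 j - psi' ord0 j| <= c) ->
  dual psi <= dual psi' + (c + c).
Proof.
move=> h.
have h1 : \int[nu]_x pmax eta (slack psi x) <=
    \int[nu]_x pmax eta (slack psi' x) + c.
  apply: integral_pmax_ler => j; have := h j; rewrite ler_norml => /andP[]; lra.
have h2 : \sum_j b j * psi ord0 j <= \sum_j b j * psi' ord0 j + c.
  rewrite -[X in _ + X]mul1r -b1 mulr_suml -big_split; apply: ler_sum => j _ /=.
  by rewrite -mulrDr ler_pM2l//; have := h j; rewrite ler_norml => /andP[]; lra.
by rewrite /dual; lra.
Qed.

(** The shift cancels because the [b j] sum to 1; this permits normalising the least coordinate of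
    [psi] to 0. *)
Let dual_shift psi c : dual (psi + const_mx c) = dual psi.
Proof.
have h1 : \int[nu]_x pmax eta (slack psi x) <=
    \int[nu]_x pmax eta (slack (psi + const_mx c) x) + c.
  by apply: integral_pmax_ler => j; rewrite !mxE.
have h2 : \int[nu]_x pmax eta (slack (psi + const_mx c) x) <=
    \int[nu]_x pmax eta (slack psi x) + - c.
  by apply: integral_pmax_ler => j; rewrite !mxE addrK.
rewrite /dual (eq_bigr (fun j => b j * psi ord0 j + b j * c)); last first.
  by move=> j _; rewrite !mxE mulrDr.
rewrite big_split /= -mulr_suml b1 mul1r; lra.
Qed.

Let M := \int[nu]_x enorm (x : 'rV[R]_n).

(** Coercivity for normalised [psi]: the coordinate [j] with [psi = 0] gives
    [pmax >= level >= - enorm x - eta], while the linear part is at least its term [j']. *)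
Let dual_ge psi j j' : (forall i, 0 <= psi ord0 i) -> psi ord0 j = 0 ->
  - M - eta + b j' * psi ord0 j' <= dual psi.
Proof.
move=> psi0 psij; apply: lerD; last first.
  by rewrite (bigD1 j')//= lerDl sumr_ge0// => i _; rewrite mulr_ge0// ltW.
have ei := finite_first_moment_integrable nu1.
rewrite lerBlDr lerNl.
have -> : - (\int[nu]_x pmax eta (slack psi x) + eta) =
  \int[nu]_x (- 1 * (pmax eta (slack psi x) + eta)).
  rewrite RintegralZl//; last first.
    by apply: integrableD_EFin => //; exact: finite_measure_integrable_cst.
  by rewrite [X in _ * X]RintegralD// (Rintegral_prob_cst nu) mulN1r.
apply: le_Rintegral => //.
  apply: integrableZl_EFin.
  exact: integrableD_EFin (pmax_integrable psi) (cst_integrable eta).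
move=> x _; rewrite mulN1r lerNl.
have := level_le_pmax eta_gt0 (slack psi x).
have := le_level m_gt0 eta_gt0 (slack psi x) j.
rewrite {1}/slack psij subr0.
have := le_dotp_enorm (- (x : 'rV[R]_n)) (Y j); rewrite dotpNl enormN.
have : enorm (x : 'rV[R]_n) * enorm (Y j) <= enorm (x : 'rV[R]_n).
  by rewrite ler_piMr ?enorm_ge0.
lra.
Qed.

(** After normalisation, a competitor either lies in a compact box, where [dual] attains its
    minimum, or has a coordinate so large that [dual_ge] puts its value above [dual 0]. *)
Let dual_min : exists psi, forall psi', dual psi <= dual psi'.
Proof.
pose c0 := `|dual 0 + M + eta|.
(* The sum dominates every [c0 / b j], hence [c0 <= b j * K] for all [j] at once. *)
pose K := \sum_j c0 / b j.
have cb_ge0 j : 0 <= c0 / b j.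
  by rewrite divr_ge0 ?(ltW (b_gt0 j))// normr_ge0.
have Kj j : c0 <= b j * K.
  rewrite /K (bigD1 j)//= mulrDr mulrC divfK ?gt_eqF// lerDl.
  by rewrite mulr_ge0 ?(ltW (b_gt0 j))// sumr_ge0// => i _; exact: cb_ge0.
have K0 : 0 <= K by rewrite sumr_ge0// => i _; exact: cb_ge0.
pose box := [set v : 'rV[R]_m | forall i, `[0, K]%classic (v ord0 i)].
have box0 : box 0 by move=> i; rewrite /= mxE in_itv/= lexx.
have cbox : compact box.
  by apply: (@rV_compact _ _ (fun=> `[0, K]%classic)) => i; exact: segment_compact.
have cd : {within box, continuous dual}.
  apply: continuous_subspaceT; apply: (@lip_continuous _ _ 2) => x y.
  have h z z' : dual z <= dual z' + (enorm (z - z') + enorm (z - z')).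
    by apply: dual_ler => j; have := coord_le_enorm (z - z') j; rewrite !mxE.
  have := h x y; have := h y x; rewrite (enormB y x) => *.
  by rewrite ler_norml; apply/andP; split; lra.
have [psi _ psiP] := EVT_min_rV (ex_intro _ _ box0) cbox cd.
exists psi => psi'.
pose i0 := Ordinal m_gt0.
case: (@arg_minP _ _ _ i0 xpredT (fun j => psi' ord0 j)) => // j _ jP.
pose p := psi' + const_mx (- psi' ord0 j).
have p0 i : 0 <= p ord0 i by rewrite !mxE subr_ge0 jP.
have pj : p ord0 j = 0 by rewrite !mxE subrr.
rewrite -(dual_shift psi' (- psi' ord0 j)) -/p.
have [pK|] := pselect (forall i, p ord0 i <= K).
  by apply: psiP; rewrite inE => i /=; rewrite in_itv/= p0 pK.
move=> /existsNP[i /negP]; rewrite -ltNge => Ki.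
have psi0 : dual psi <= dual 0 by apply: psiP; rewrite inE.
apply: (le_trans psi0); apply: le_trans (dual_ge i p0 pj).
have : b i * K <= b i * p ord0 i by rewrite ler_pM2l// ltW.
have := Kj i; have := ler_norm (dual 0 + M + eta); rewrite -/c0; lra.
Qed.

(** First-order condition at a minimiser: moving coordinate [j] by [t] changes [dual] by at most
    [t * (b j - I) + t ^+ 2 / (2 * eta)], with [I] the integral of the weight. No differentiation
    under the integral is involved. *)
Lemma weight_marginal_exists :
  exists psi, forall j, \int[nu]_x weight eta (slack psi x) j = b j.
Proof.
have [psi psiP] := dual_min; exists psi => j.
apply/eqP; rewrite eq_sym -subr_eq0; apply/eqP.
apply: (@quad_ineq_eq0 _ _ (2 * eta)^-1) => t.
have := psiP (psi + t *: delta_mx 0 j); rewrite /dual.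
set I := \int[nu]_x weight _ _ _.
have -> : \sum_i b i * (psi + t *: delta_mx 0 j) ord0 i =
    \sum_i b i * psi ord0 i + b j * t.
  rewrite (eq_bigr (fun i => b i * psi ord0 i + b i * (t * (i == j)%:R))); last first.
    by move=> i _; rewrite !mxE/= mulrDr.
  rewrite big_split/=; congr (_ + _); rewrite (bigD1 j)//= eqxx mulr1.
  by rewrite big1 ?addr0// => i /negbTE ->; rewrite !mulr0.
have : \int[nu]_x pmax eta (slack (psi + t *: delta_mx 0 j) x) <=
    \int[nu]_x pmax eta (slack psi x) + ((- t) * I + t ^+ 2 / (2 * eta)).
  rewrite /I -RintegralZl//; last exact: integrable_weight.
  have wi : nu.-integrable setT
      (EFin \o (fun x : Rd R n => - t * weight eta (slack psi x) j)).
    by apply: integrableZl_EFin; exact: integrable_weight.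
  have wi2 : nu.-integrable setT
      (EFin \o (fun x : Rd R n =>
         - t * weight eta (slack psi x) j + t ^+ 2 / (2 * eta))).
    by apply: integrableD_EFin => //; exact: finite_measure_integrable_cst.
  rewrite -[X in _ + (_ + X)](Rintegral_prob_cst nu) -RintegralD// -RintegralD//.
  apply: le_Rintegral => //.
    exact: integrableD_EFin.
  move=> x _; rewrite addrA mulNr; apply: (pmax_descent m_gt0 eta_gt0).
    by rewrite /slack !mxE !eqxx/= mulr1 opprD addrA.
  by move=> i ij; rewrite /slack !mxE (negbTE ij) andbF mulr0 addr0.
lra.
Qed.

End semidiscrete.

(** * Probability measures given by a density *)

Section density.
Context d (T : measurableType d) {R : realType} (mu : {measure set T -> \bar R}).
Variable h : T -> R.

(** The proofs are arguments so that the measure and probability structures can be attached to the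
    term itself. *)
Definition density (h0 : forall x, 0 <= h x) (mh : measurable_fun setT h)
    (h1 : (\int[mu]_x (h x)%:E = 1)%E) : set T -> \bar R :=
  fun A => (\int[mu]_(x in A) (h x)%:E)%E.

Variables (h0 : forall x, 0 <= h x) (mh : measurable_fun setT h)
  (h1 : (\int[mu]_x (h x)%:E = 1)%E).

Let density0 : density h0 mh h1 set0 = 0%E.
Proof. by rewrite /density integral_set0. Qed.

Let density_ge0 A : (0 <= density h0 mh h1 A)%E.
Proof. by apply: integral_ge0 => x _; rewrite lee_fin. Qed.

Let density_sigma_additive : semi_sigma_additive (density h0 mh h1).
Proof.
move=> /= F mF tF mUF; rewrite /density; apply: cvg_toP.
  apply: ereal_nondecreasing_is_cvgn => m n mn.
  apply: lee_sum_nneg_natr => // k _ _.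
  by apply: integral_ge0 => x _; rewrite lee_fin.
rewrite ge0_integral_bigcup//=.
- by apply: measurable_funTS; exact/measurable_EFinP.
- by move=> x _; rewrite lee_fin.
Qed.

HB.instance Definition _ := isMeasure.Build _ _ _ (density h0 mh h1)
  density0 density_ge0 density_sigma_additive.

Let density_setT : density h0 mh h1 setT = 1%E.
Proof. exact: h1. Qed.

HB.instance Definition _ := @Measure_isProbability.Build _ _ R
  (density h0 mh h1) density_setT.

End density.

Lemma integral_lincomb d (T : measurableType d) (R : realType)
    (mu : {measure set T -> \bar R}) m (c : 'I_m -> R) (g : 'I_m -> T -> R)
    (b : 'I_m -> R) :
  (forall j, 0 <= c j) -> (forall j x, 0 <= g j x) ->
  (forall j, measurable_fun setT (g j)) ->
  (forall j, (\int[mu]_x (g j x)%:E = (b j)%:E)%E) ->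
  (\int[mu]_x (\sum_j c j * g j x)%:E = (\sum_j c j * b j)%:E)%E.
Proof.
move=> c0 g0 mg gb.
under eq_integral => x _ do rewrite -sumEFin.
rewrite ge0_integral_sum//.
- rewrite -sumEFin; apply: eq_bigr => j _.
  under eq_integral => x _ do rewrite EFinM.
  rewrite ge0_integralZl_EFin ?gb//.
  + by move=> x _; rewrite lee_fin.
  + exact/measurable_EFinP.
- by move=> j; apply/measurable_EFinP; exact: measurable_funM.
- by move=> j x _; rewrite lee_fin mulr_ge0.
Qed.

Lemma sum_indic_trivIset (R : realType) (T : Type) m (B : 'I_m -> set T)
    (c : 'I_m -> R) j y : trivIset setT B -> B j y ->
  \sum_i c i * \1_(B i) y = c j.
Proof.
move=> tB By; rewrite (bigD1 j)//= indicE mem_set// mulr1 big1 ?addr0// => i ij.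
rewrite indicE memNset ?mulr0// => Biy.
by move/eqP: ij; apply; apply: tB => //; exists y.
Qed.

(** * The coupling built from the weights *)

Section semidiscrete_coupling.
Context {R : realType} {n m : nat}.
Variables (nu rho : probability (Rd R n) R) (B : 'I_m -> set (Rd R n)).
Hypotheses (mB : forall j, measurable (B j)) (tB : trivIset setT B).
Hypothesis B_gt0 : forall j, (0 < rho (B j))%E.
Hypothesis B_cover : rho (~` \bigcup_j B j) = 0%E.
Variable w : 'I_m -> Rd R n -> R.
Hypotheses (w0 : forall j x, 0 <= w j x) (mw : forall j, measurable_fun setT (w j)).
Hypotheses (w1 : forall x, \sum_j w j x = 1).
Let b j := fine (rho (B j)).
Hypothesis wb : forall j, (\int[nu]_x (w j x)%:E = (b j)%:E)%E.

Let rhoE j : rho (B j) = (b j)%:E.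
Proof. by rewrite /b fineK// fin_num_measure. Qed.

Let b_gt0 j : 0 < b j. Proof. by have := B_gt0 j; rewrite rhoE lte_fin. Qed.

Let intB j : (\int[rho]_y (\1_(B j) y)%:E = (b j)%:E)%E.
Proof. by rewrite integral_indic// setIT; exact: rhoE. Qed.

Let mU : measurable (\bigcup_j B j).
Proof. by apply: fin_bigcup_measurable => //; exact: finite_finset. Qed.

(** Density with respect to the product of [nu] and [rho]: given [x], a cell is drawn with
    probabilities [w j x], then [y] from [rho] conditioned on that cell. *)
Definition cdens (z : Rd R n * Rd R n) : R := \sum_j w j z.1 / b j * \1_(B j) z.2.

Let cdens_ge0 z : 0 <= cdens z.
Proof.
by apply: sumr_ge0 => j _; rewrite mulr_ge0// divr_ge0// ltW.
Qed.

Let measurable_cdens : measurable_fun setT cdens.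
Proof.
apply: measurable_sum => j; apply: measurable_funM.
  by apply: measurable_funM => //; exact: (measurableT_comp (mw j) measurable_fst).
by apply: (measurableT_comp _ measurable_snd); exact: measurable_indic.
Qed.

Let integral_cdens_fst (A : set (Rd R n)) : measurable A ->
  (\int[nu \x rho]_(z in A `*` setT) (cdens z)%:E = nu A)%E.
Proof.
move=> mA; rewrite integral_mkcond.
rewrite (_ : (fun z => _) \_ _ = fun z => (\1_A z.1 * cdens z)%:E); last first.
  apply/funext => -[x y]; rewrite /patch/= indicE.
  case: ifPn => [/set_mem[/= Ax _]|/negP xA]; first by rewrite mem_set// mul1r.
  by rewrite memNset ?mul0r// => Ax; apply: xA; apply/mem_set.
rewrite fubini_tonelli1; last 2 first.
- apply/measurable_EFinP; apply: measurable_funM => //.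
  by apply: (measurableT_comp _ measurable_fst); exact: measurable_indic.
- by move=> z; rewrite lee_fin mulr_ge0.
transitivity (\int[nu]_x (\1_A x)%:E)%E; last by rewrite integral_indic// setIT.
apply: eq_integral => x _.
rewrite /fubini_F /cdens/=.
under eq_integral => y _.
  rewrite mulr_sumr; under eq_bigr => j _ do rewrite mulrA; over.
rewrite (integral_lincomb _ _ _ intB)//.
- congr EFin; rewrite -[RHS]mulr1 -(w1 x) mulr_sumr; apply: eq_bigr => j _.
  by rewrite -mulrA divfK// gt_eqF.
- by move=> j; rewrite mulr_ge0// divr_ge0// ltW.
- by move=> j; exact: measurable_indic.
Qed.

(** Integrating in [x] first turns each [w j] into [b j], which cancels the denominator; what
    remains is the mass of [A] inside the cells, all of it by [B_cover]. *)
Let integral_cdens_snd (A : set (Rd R n)) : measurable A ->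
  (\int[nu \x rho]_(z in setT `*` A) (cdens z)%:E = rho A)%E.
Proof.
move=> mA; rewrite integral_mkcond.
rewrite (_ : (fun z => _) \_ _ = fun z => (\1_A z.2 * cdens z)%:E); last first.
  apply/funext => -[x y]; rewrite /patch/= indicE.
  case: ifPn => [/set_mem[/= _ Ax]|/negP xA]; first by rewrite mem_set// mul1r.
  by rewrite memNset ?mul0r// => Ax; apply: xA; apply/mem_set.
rewrite fubini_tonelli2; last 2 first.
- apply/measurable_EFinP; apply: measurable_funM => //.
  by apply: (measurableT_comp _ measurable_snd); exact: measurable_indic.
- by move=> z; rewrite lee_fin mulr_ge0.
transitivity (\int[rho]_y (\1_(A `&` \bigcup_j B j) y)%:E)%E; last first.
  have mAU := measurableI _ _ mA mU.
  rewrite integral_indic// setIT [RHS](measureDI _ mA mU).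
  rewrite [X in (X + _)%E](_ : _ = 0%E) ?add0e//.
  apply/eqP; rewrite -measure_le0 -B_cover; apply: le_measure; rewrite ?inE.
  - exact: measurableD.
  - exact: measurableC.
  - by move=> y [].
apply: eq_integral => y _; rewrite /fubini_G /cdens/=.
under eq_integral => x _.
  rewrite mulr_sumr; under eq_bigr => j _.
    rewrite [_ * _](_ : _ = \1_A y / b j * \1_(B j) y * w j x); last by ring.
    over.
  over.
rewrite (integral_lincomb _ _ _ wb)//; last first.
  by move=> j; rewrite mulr_ge0// divr_ge0// ltW.
congr EFin; rewrite indicI/=.
rewrite (eq_bigr (fun j => \1_A y * \1_(B j) y)); last first.
  by move=> j _; field; rewrite gt_eqF.
rewrite -mulr_sumr; congr (_ * _).
have [[j _ By]|yU] := pselect ((\bigcup_j B j) y).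
  rewrite [RHS]indicE mem_set; last by exists j.
  rewrite -[RHS](@sum_indic_trivIset R _ _ B (fun=> 1) _ _ tB By).
  by apply: eq_bigr => i _; rewrite mul1r.
rewrite [RHS]indicE memNset//; apply: big1 => j _.
by rewrite indicE memNset// => By; apply: yU; exists j.
Qed.

Let integral_cdens : (\int[nu \x rho]_z (cdens z)%:E = 1)%E.
Proof. by rewrite -setXTT integral_cdens_fst// probability_setT. Qed.

Lemma semidiscrete_coupling :
  exists pi : probability (Rd R n * Rd R n)%type R, coupling nu rho pi /\
  exists E : set (Rd R n * Rd R n), [/\ measurable E, pi (~` E) = 0%E &
    forall z, E z -> exists2 j, B j z.2 & 0 < w j z.1].
Proof.
exists (density cdens_ge0 measurable_cdens integral_cdens); split.
  by split=> A mA; [exact: integral_cdens_fst|exact: integral_cdens_snd].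
(* Off this set every term of [cdens] has a vanishing indicator or a vanishing weight, so it carries
   no mass. *)
exists (\bigcup_j (snd @^-1` (B j) `&` (w j \o fst) @^-1` `]0, +oo[)); split.
- apply: fin_bigcup_measurable => [|j _]; first exact: finite_finset.
  apply: measurableI.
    by rewrite -[X in measurable X]setTI; exact: measurable_snd.
  rewrite -[X in measurable X]setTI.
  by apply: (measurableT_comp (mw j) measurable_fst) => //; exact: measurable_itv.
- rewrite /= /density; apply: integral0_eq => z zE; congr EFin.
  apply: big1 => j _; rewrite indicE.
  have [Bz|Bz] := pselect (B j z.2); last by rewrite memNset// mulr0.
  have [wz|] := ltP 0 (w j z.1).
    by exfalso; apply: zE; exists j => //; split => //=; rewrite in_itv/= wz.
  by move=> wz; rewrite (_ : w j z.1 = 0) ?mul0r//; apply/eqP; rewrite eq_le wz w0.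
- by move=> z [j _ [/= Bz]]; rewrite in_itv/= andbT; exists j.
Qed.

End semidiscrete_coupling.

(** * From a target measure to a potential *)

Section transport_to_potential.
Context {R : realType} {n : nat} (mu nu rho : probability (Rd R n) R).
Hypotheses (mu1 : finite_first_moment mu) (nu1 : finite_first_moment nu).
Hypothesis rho_uball : rho (~` uball) = 0%E.

Let mom (al : probability (Rd R n) R) := \int[al]_x enorm (x : 'rV[R]_n).

(** Replacing [y] by its centre [Y j] costs [delta * enorm x] on each side; the smoothing costs
    [eta] only for [mu]. The constant [c], the integral of the dual potential against [rho], is
    common to both bounds and cancels in their difference. *)
Let approx (delta eta : R) : 0 < delta -> 0 < eta ->
  exists f : 'rV[R]_n -> R, convex_1lip f /\ exists c : R,
    ((\int[nu]_x f x - delta * mom nu + c)%:E <= Ccost nu rho)%E /\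
    (Ccost mu rho <= (\int[mu]_x f x + delta * mom mu + eta + c)%:E)%E.
Proof.
move=> d0 e0.
have [m [B [Y [mB tB B_cover Y1 YB]]]] := small_partition rho_uball d0.
pose b j := fine (rho (B j)).
have rhoE j : rho (B j) = (b j)%:E.
  by rewrite /b fineK// fin_num_measure//; case: (mB j).
have b_gt0 j : 0 < b j by have [_] := mB j; rewrite rhoE lte_fin.
have mU : measurable (\bigcup_j B j).
  by apply: fin_bigcup_measurable => [|j _]; [exact: finite_finset|case: (mB j)].
have rhoU : rho (\bigcup_j B j) = 1%E.
  have := probability_setC rho mU; rewrite B_cover.
  have : rho (\bigcup_j B j) \is a fin_num by rewrite fin_num_measure.
  case: (rho _) => // r _ /eqP.
  by rewrite -EFinB eqe eq_sym subr_eq0 => /eqP <-.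
have b1 : \sum_j b j = 1.
  apply: EFin_inj; rewrite -rhoU -sumEFin.
  have -> : \bigcup_j B j = \big[setU/set0]_(j in 'I_m) B j.
    by rewrite -bigcup_pred; congr bigcup; apply/seteqP; split.
  rewrite measure_bigsetU_ord//; last by move=> j; case: (mB j).
  by apply: eq_big => // j _; rewrite -rhoE.
have m_gt0 : (0 < m)%N.
  by case: (m) (b) b1 => // b' /eqP; rewrite big_ord0 eq_sym oner_eq0.
have [psi psiP] := @weight_marginal_exists R n m nu Y b eta m_gt0 e0 nu1 Y1 b_gt0 b1.
pose f := pot Y eta psi.
have fC : convex_1lip f by exact: pot_convex_1lip.
have fi al : finite_first_moment al ->
    al.-integrable setT (EFin \o (f : Rd R n -> R)).
  by move=> al1; apply: lip_integrable => //; case: fC.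
have ei al : finite_first_moment al ->
    al.-integrable setT (EFin \o (@enorm R n : Rd R n -> R)).
  exact: finite_first_moment_integrable.
have eZ al c : finite_first_moment al ->
    al.-integrable setT (EFin \o (fun x : Rd R n => c * enorm (x : 'rV[R]_n))).
  by move=> al1; apply: integrableZl_EFin; exact: ei.
pose Psi (y : Rd R n) := \sum_j psi ord0 j * \1_(B j) y.
have Psii : rho.-integrable setT (EFin \o Psi).
  apply: (integrable_affine_bound (g := fun=> 0) (a := \sum_j `|psi ord0 j|)).
  - apply: measurable_sum => j; apply: measurable_funM => //.
    by apply: measurable_indic; case: (mB j).
  - exact: integrable0.
  - move=> y; rewrite normr0 add0r (le_trans (ler_norm_sum _ _ _))//.
    apply: ler_sum => j _; rewrite normrM ler_piMr// indicE.
    by case: (_ \in _); rewrite ?normr1 ?normr0.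
have PsiE j y : B j y -> Psi y = psi ord0 j.
  by move=> By; rewrite /Psi (sum_indic_trivIset (fun j => psi ord0 j) tB By).
have dotB j (x y : 'rV[R]_n) : B j y ->
    `|dotp x y - dotp x (Y j)| <= delta * enorm x.
  move=> By; rewrite -dotpNr -dotpDr (le_trans (normr_dotp_le _ _))// mulrC.
  by rewrite ler_wpM2r ?enorm_ge0//; exact: YB.
exists f; split => //; exists (\int[rho]_y Psi y); split.
- pose w j (x : Rd R n) := weight eta (slack Y psi x) j.
  have [||||||pi [cpi [E [mE E0 EP]]]] :=
    @semidiscrete_coupling R n m nu rho B _ tB _ B_cover w.
  + by move=> j; case: (mB j).
  + by move=> j; case: (mB j).
  + by move=> j x; exact: weight_ge0.
  + by move=> j; exact: measurable_weight.
  + by move=> x; exact: sum_weight.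
  + move=> j; rewrite EFin_Rintegral ?psiP//; exact: integrable_weight.
  apply: le_trans (le_Ccost nu1 rho_uball cpi); rewrite lee_fin.
  have i1 : nu.-integrable setT
      (EFin \o (fun x : Rd R n => f x + - delta * enorm (x : 'rV[R]_n))).
    by apply: (integrableD_EFin (fi _ nu1)); exact: eZ.
  have -> : \int[nu]_x f x - delta * mom nu =
      \int[nu]_x (f x + - delta * enorm (x : 'rV[R]_n)).
    rewrite (RintegralD _ (fi _ nu1) (eZ _ _ nu1))//.
    by rewrite (RintegralZl _ _ (ei _ nu1))// mulNr.
  rewrite -(Rintegral_coupling_sum cpi)//.
  apply: (le_Rintegral_null mE E0).
  + exact: (integrable_coupling_sum cpi i1 Psii).
  + exact: (integrable_coupling_dotp cpi nu1 rho_uball).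
  move=> z /EP[j Bz wz]; rewrite (PsiE _ _ Bz).
  have := weight_gt0 e0 wz; rewrite -/(pot Y eta psi z.1) -/f /slack.
  by have := dotB _ z.1 _ Bz; rewrite ler_norml => /andP[]; lra.
- have -> : \int[mu]_x f x + delta * mom mu + eta =
      \int[mu]_x (f x + delta * enorm (x : 'rV[R]_n) + eta).
    rewrite RintegralD//; last 2 first.
    - by apply: (integrableD_EFin (fi _ mu1)); exact: eZ.
    - exact: finite_measure_integrable_cst.
    rewrite Rintegral_prob_cst (RintegralD _ (fi _ mu1) (eZ _ _ mu1))//.
    by rewrite (RintegralZl _ _ (ei _ mu1)).
  apply: (Ccost_le_potentials mu1 rho_uball mU B_cover) => //.
    apply: integrableD_EFin; last exact: finite_measure_integrable_cst.
    by apply: (integrableD_EFin (fi _ mu1)); exact: eZ.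
  move=> x y [j _ By]; rewrite (PsiE _ _ By).
  have := le_level m_gt0 e0 (slack Y psi x) j.
  rewrite -/(pot Y eta psi x) -/f /slack.
  by have := dotB _ x _ By; rewrite ler_norml => /andP[]; lra.
Qed.

Lemma exists_potential (eps : R) : 0 < eps ->
  exists f : 'rV[R]_n -> R, convex_1lip f /\
    ((\int[nu]_x f x - \int[mu]_x f x)%:E <=
     Ccost nu rho - Ccost mu rho + eps%:E)%E.
Proof.
move=> e0; have k0 : 0 < mom nu + mom mu + 1.
  by rewrite ltr_wpDl// addr_ge0// Rintegral_ge0// => x _; exact: enorm_ge0.
(* Half of [eps] pays for the cell size against both moments, half for the smoothing; the summand 1
   keeps the denominator positive. *)
have d0 : 0 < eps / (2 * (mom nu + mom mu + 1)) by rewrite divr_gt0// mulr_gt0.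
have e2 : 0 < eps / 2 by rewrite divr_gt0.
have [f [fC [c [h1 h2]]]] := approx d0 e2; exists f; split => //.
have := leeB h1 h2; rewrite -EFinB => /(leeD2r eps%:E); apply: le_trans.
rewrite -EFinD lee_fin; set dl := eps / (2 * _).
have : dl * (mom nu + mom mu) <= eps / 2.
  rewrite [leRHS](_ : _ = dl * (mom nu + mom mu + 1)); last first.
    by rewrite /dl invfM mulrA divfK// gt_eqF.
  by rewrite ler_wpM2l ?(ltW d0)// lerDl.
rewrite mulrDr; lra.
Qed.

End transport_to_potential.

(** * Almost optimal targets for a given potential *)

Lemma small_quad_ge0 (R : realType) (a c : R) : 0 <= c ->
  (forall t, 0 < t <= 1 -> 0 <= t * a + t ^+ 2 * c) -> 0 <= a.
Proof.
move=> c0 h; rewrite leNgt; apply/negP => a0.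
have ca : 0 < c - a by lra.
(* For [a < 0 <= c] this lies in (0, 1] and the expression becomes [- t * a ^+ 2 / (c - a) < 0]. *)
pose t := - a / (c - a).
have t0 : 0 < t by rewrite divr_gt0// oppr_gt0.
have t1 : t <= 1 by rewrite ler_pdivrMr// mul1r; lra.
have := h t; rewrite t0 t1 => /(_ isT).
rewrite (_ : _ + _ = t * (- (a * a) / (c - a))); last first.
  by rewrite /t; field; rewrite gt_eqF.
rewrite pmulr_rge0// pmulr_lge0 ?invr_gt0// oppr_ge0 leNgt.
by rewrite nmulr_lgt0// a0.
Qed.

(** * The proximal map of a convex 1-Lipschitz function *)

Section proximal_map.
Context {R : realType} {n : nat} (f : 'rV[R]_n -> R) (lam : R).
Hypotheses (fC : convex_1lip f) (lam_gt0 : 0 < lam).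

Let flip x y : f x <= f y + enorm (x - y).
Proof. by have [_ /(_ x y)] := fC; rewrite ler_norml => /andP[]; lra. Qed.

Let penal (x z : 'rV[R]_n) := f z + enorm (z - x) ^+ 2 / (2 * lam).

(** Outside the box [enorm (z - x) > 2 * lam], so the quadratic term exceeds [enorm (z - x)] and
    hence [f x - f z]: such [z] does no better than [x], and compactness of the box suffices. *)
Let penal_min x : exists p, forall z, penal x p <= penal x z.
Proof.
pose box := [set v : 'rV[R]_n |
  forall i, `[x ord0 i - 2 * lam, x ord0 i + 2 * lam]%classic (v ord0 i)].
have boxx : box x.
  by move=> i; rewrite /= in_itv/=; apply/andP; split; have := lam_gt0; lra.
have cbox : compact box.
  apply: (@rV_compact _ _
    (fun i => `[x ord0 i - 2 * lam, x ord0 i + 2 * lam]%classic)) => i.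
  exact: segment_compact.
have cq : {within box, continuous (penal x)}.
  have ce : continuous (fun z : 'rV[R]_n => enorm (z - x)).
    apply: (@lip_continuous _ _ 1) => y z; rewrite mul1r.
    by rewrite (le_trans (lip_enorm _ _))// opprB addrA subrK.
  have cf : continuous f.
    by apply: (@lip_continuous _ _ 1) => y z; rewrite mul1r; case: fC.
  apply: continuous_subspaceT => z.
  apply: (@continuousD _ _ _ f (fun z => enorm (z - x) ^+ 2 / (2 * lam))) => //.
  - by have := cf z.
  - pose g (r : R) := r ^+ 2 / (2 * lam).
    apply: (@continuous_comp _ _ _ (fun z : 'rV[R]_n => enorm (z - x)) g).
      by have := ce z.
    apply: (@continuousM _ _ (fun r : R => r ^+ 2) (fun=> (2 * lam)^-1)).
      exact: exprn_continuous.
    exact: cvg_cst.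
have [p _ pP] := EVT_min_rV (ex_intro _ _ boxx) cbox cq.
exists p => z.
have [zb|] := pselect (box z); first by apply: pP; rewrite inE.
move=> /existsNP[i zi]; apply: (@le_trans _ _ (penal x x)).
  by apply: pP; rewrite inE.
rewrite /penal subrr enorm0 expr0n/= mul0r addr0.
have {}zi : 2 * lam < enorm (z - x).
  rewrite ltNge; apply/negP => zx; apply: zi; rewrite /= in_itv/=.
  have := le_trans (coord_le_enorm (z - x) i) zx; rewrite !mxE ler_norml.
  by move=> /andP[? ?]; apply/andP; split; lra.
have := flip x z; rewrite enormB => /le_trans; apply; rewrite lerD2l.
by rewrite ler_pdivlMr ?mulr_gt0// expr2 ler_wpM2l ?enorm_ge0// ltW.
Qed.

Definition prox (x : 'rV[R]_n) : 'rV[R]_n :=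
  xget 0 [set p | forall z, penal x p <= penal x z].

Let proxP x z : penal x (prox x) <= penal x z.
Proof.
rewrite /prox; case: xgetP => [p -> h|h]; first exact: h.
by have [p pP] := penal_min x; case: (h p).
Qed.

(* The gradient of the Moreau envelope of [f], which selects a subgradient of [f]
   at [prox x]. *)
Definition sgrad (x : 'rV[R]_n) : 'rV[R]_n := lam^-1 *: (x - prox x).

(** Compare the minimiser [p] with [p + t (z - p)]: convexity of [f] and expansion of the square
    leave a linear term plus a nonnegative multiple of [t ^+ 2], and small [t] decides the sign of
    the linear coefficient. *)
Lemma sgrad_subgradient x z :
  f (prox x) + dotp (sgrad x) (z - prox x) <= f z.
Proof.
set p := prox x.
suff : 0 <= f z - f p - dotp (sgrad x) (z - p) by lra.
apply: (@small_quad_ge0 _ _ (dotp (z - p) (z - p) / (2 * lam))).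
  by rewrite divr_ge0 ?dotpxx_ge0// mulr_ge0// ltW.
move=> t /andP[t0 t1]; have [fc _] := fC.
have := proxP x (t *: z + (1 - t) *: p); rewrite -/p /penal.
have := fc z p t (ltW t0) t1.
have -> : t *: z + (1 - t) *: p - x = (p - x) + t *: (z - p).
  by apply/rowP => i; rewrite !mxE; ring.
rewrite !sqr_enorm; move: (z - p) => v.
have -> : dotp (sgrad x) v = - lam^-1 * dotp (p - x) v.
  by rewrite /sgrad -/p -opprB scalerN -scaleNr dotpZl.
have -> : dotp (p - x + t *: v) (p - x + t *: v) =
    dotp (p - x) (p - x) + 2 * t * dotp (p - x) v + t ^+ 2 * dotp v v.
  rewrite dotpDl !(dotpDr _ (t *: v)) !dotpZl !dotpZr (dotpC v).
  by rewrite expr2; ring.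
rewrite !invfM; move: (dotp _ _) (dotp _ _) (dotp _ _) => a b c; lra.
Qed.

(** Testing the subgradient [s] at [prox x + s] gives [enorm s ^+ 2 <= enorm s] by the Lipschitz
    bound. *)
Lemma enorm_sgrad_le1 x : enorm (sgrad x) <= 1.
Proof.
have := sgrad_subgradient x (prox x + sgrad x); rewrite addrAC subrr add0r -sqr_enorm.
have := flip (prox x + sgrad x) (prox x); rewrite addrAC subrr add0r => h1 h2.
have [->|s0] := eqVneq (enorm (sgrad x)) 0; first exact: ler01.
have s_gt0 : 0 < enorm (sgrad x) by rewrite lt_neqAle eq_sym s0 enorm_ge0.
by rewrite -(ler_pM2l s_gt0) mulr1 -expr2; lra.
Qed.

Lemma sgradE x : x = prox x + lam *: sgrad x.
Proof.
by rewrite /sgrad scalerA divff ?gt_eqF// scale1r addrC subrK.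
Qed.

(** The two subgradient inequalities add up to monotonicity of the subgradients; with
    [x = prox x + lam *: sgrad x] this bounds the squared distance by
    [dotp (x - y) (prox x - prox y)], and Cauchy-Schwarz finishes. *)
Lemma prox_nonexpansive x y : enorm (prox x - prox y) <= enorm (x - y).
Proof.
have := sgrad_subgradient x (prox y); have := sgrad_subgradient y (prox x).
move=> h1 h2.
have h : enorm (prox x - prox y) ^+ 2 <= dotp (x - y) (prox x - prox y).
  rewrite sqr_enorm -subr_ge0 -dotpNl -dotpDl.
  rewrite [X in dotp X](_ : _ = lam *: (sgrad x - sgrad y)); last first.
    rewrite {1}(sgradE x) {1}(sgradE y).
    by apply/rowP => i; rewrite !mxE; ring.
  rewrite dotpZl mulr_ge0 ?(ltW lam_gt0)// dotpDl dotpNl.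
  by move: h2; rewrite -opprB dotpNr; lra.
have [->|s0] := eqVneq (enorm (prox x - prox y)) 0; first exact: enorm_ge0.
have s_gt0 : 0 < enorm (prox x - prox y) by rewrite lt_neqAle eq_sym s0 enorm_ge0.
by rewrite -(ler_pM2r s_gt0) -expr2 (le_trans h)// le_dotp_enorm.
Qed.

Lemma continuous_sgrad : continuous sgrad.
Proof.
apply: (@lip_continuousT _ _ (lam^-1 * 2)) => x y.
rewrite /sgrad -scalerBr enormZ ger0_norm ?invr_ge0 ?(ltW lam_gt0)// -mulrA.
rewrite ler_pM2l ?invr_gt0// [X in enorm X <= _](_ : _ = (x - y) + (prox y - prox x)).
  have := enormD (x - y) (prox y - prox x).
  by have := prox_nonexpansive y x; rewrite (enormB y x); lra.
by apply/rowP => i; rewrite !mxE; ring.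
Qed.

End proximal_map.

(** * The convex conjugate *)

Section conjugate.
Context {R : realType} {n : nat} (f : 'rV[R]_n -> R).

Definition conjugate (y : Rd R n) : \bar R :=
  ereal_sup [set (dotp z (y : 'rV[R]_n) - f z)%:E | z in setT].

(** Lower semicontinuity: strict superlevel sets are unions of open half-spaces, and an uncountable
    union of open sets is still open. *)
Lemma measurable_conjugate : measurable_fun setT conjugate.
Proof.
apply: (measurability _ (ErealGenOInfty.measurableE R)).
move=> /= _ [_ [a ->]] <-; rewrite setTI preimage_itvoy.
rewrite [X in measurable X](_ : _ =
    \bigcup_(z in setT) [set y : 'rV[R]_n | a + f z < dotp y z]).
  apply: open_Rd_measurable; apply: bigcup_open => z _.
  have /continuousP/(_ _ (@open_gt R (a + f z))) := @continuous_dotpr R n z.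
  exact.
apply/seteqP; split => y /=.
  move=> /ereal_sup_gt[_ [z _ <-]]; rewrite lte_fin dotpC => h.
  by exists z => //=; lra.
move=> [z _ /= h].
have : ((dotp z y - f z)%:E <= conjugate y)%E by apply: ereal_sup_ubound; exists z.
by apply: lt_le_trans; rewrite lte_fin (dotpC z); lra.
Qed.

Lemma dotp_le_conjugate x (y : Rd R n) : conjugate y \is a fin_num ->
  dotp x (y : 'rV[R]_n) <= f x + fine (conjugate y).
Proof.
move=> yf; rewrite -lerBlDl -lee_fin fineK//.
by apply: ereal_sup_ubound; exists x.
Qed.

(** Equality case of the Fenchel inequality: a subgradient [y] at [p] makes [p] a maximiser in the
    supremum. *)
Lemma conjugate_subgradient p (y : 'rV[R]_n) :
  (forall z, f p + dotp y (z - p) <= f z) -> conjugate y = (dotp p y - f p)%:E.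
Proof.
move=> py; apply/eqP; rewrite eq_le; apply/andP; split.
  apply: ge_ereal_sup => _ [z _ <-]; rewrite lee_fin.
  by have := py z; rewrite dotpDr dotpNr !(dotpC y); lra.
by apply: ereal_sup_ubound; exists p.
Qed.

End conjugate.

(** * From a potential to a target measure *)

Section potential_to_transport.
Context {R : realType} {n : nat} (mu nu : probability (Rd R n) R).
Hypotheses (mu1 : finite_first_moment mu) (nu1 : finite_first_moment nu).

Lemma exists_target (f : 'rV[R]_n -> R) (lam : R) : convex_1lip f -> 0 < lam ->
  exists rho : probability (Rd R n) R, P1 rho /\
    (Ccost nu rho - Ccost mu rho <=
     (\int[nu]_x f x - \int[mu]_x f x + lam)%:E)%E.
Proof.
move=> fC l0.
pose T : Rd R n -> Rd R n := sgrad f lam.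
have mT : measurable_fun setT T.
  by apply: continuous_Rd_measurableT; exact: continuous_sgrad.
pose Tm : {mfun Rd R n >-> Rd R n} :=
  HB.pack T (isMeasurableFun.Build _ _ _ _ T mT).
pose rho : probability (Rd R n) R := distribution mu Tm.
have rho_null (A : set (Rd R n)) : (forall x, A (T x)) -> rho (~` A) = 0%E.
  move=> AT; transitivity (mu (T @^-1` (~` A))) => //.
  rewrite [X in mu X](_ : _ = set0) ?measure0//.
  by apply/seteqP; split => x //= /(_ (AT x)).
have rho_uball : rho (~` uball) = 0%E.
  by apply: rho_null => x; exact: enorm_sgrad_le1.
have mgr : measurable_fun setT (fun x => (x, T x)).
  by apply/measurable_fun_pairP; split => //; exact: measurable_id.
pose grm : {mfun Rd R n >-> (Rd R n * Rd R n)%type} :=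
  HB.pack (fun x => (x, T x)) (isMeasurableFun.Build _ _ _ _ _ mgr).
pose pi : probability (Rd R n * Rd R n)%type R := distribution mu grm.
have cpi : coupling mu rho pi.
  split=> A mA; rewrite /pi /rho /distribution /= /pushforward; congr (mu _).
    by apply/seteqP; split => x //= [].
  by apply/seteqP; split => x //= [].
exists rho; split; first exact: uball_P1.
have conjT x : conjugate f (T x) =
    (dotp (prox f lam x) (T x : 'rV[R]_n) - f (prox f lam x))%:E.
  by apply: conjugate_subgradient => z; exact: sgrad_subgradient.
pose psi (y : Rd R n) := fine (conjugate f y).
have mpsi : measurable_fun setT psi.
  by apply: (measurableT_comp _ (measurable_conjugate f)); exact: fine_measurable.
have fi al : finite_first_moment al ->
    al.-integrable setT (EFin \o (f : Rd R n -> R)).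
  by move=> al1; apply: lip_integrable => //; case: fC.
have xp (x : 'rV[R]_n) : enorm (x - prox f lam x) <= lam.
  rewrite {1}(sgradE f l0 x) addrAC subrr add0r enormZ (gtr0_norm l0).
  by rewrite ler_piMr ?(ltW l0)//; exact: enorm_sgrad_le1.
(* With [p = prox x], [psi (T x)] is bounded by [enorm p + |f p|], hence by [2 * enorm p + |f 0|],
   and [p] is within [lam] of [x]. *)
have psiT : mu.-integrable setT (EFin \o (fun x => psi (T x))).
  apply: (integrable_affine_bound (g := fun x : Rd R n => 2 * enorm (x : 'rV[R]_n))
    (a := 2 * lam + `|f 0|)).
  - exact: measurableT_comp.
  - exact/integrableZl_EFin/finite_first_moment_integrable.
  - move=> x; rewrite /psi conjT/=; set p := prox f lam x.
    have h1 := normr_dotp_le p (sgrad f lam x).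
    have h2 : enorm p * enorm (sgrad f lam x) <= enorm p.
      by rewrite ler_piMr ?enorm_ge0//; exact: enorm_sgrad_le1.
    have h3 : `|f p - f 0| <= enorm (p - 0) by case: fC.
    have h4 := enormD x (p - x); rewrite addrC subrK (enormB p) in h4.
    have h5 := xp x.
    rewrite normrM (ger0_norm (enorm_ge0 _)) (ger0_norm (_ : 0 <= 2))//.
    rewrite (le_trans (ler_normB _ _))//.
    have := ler_normD (f p - f 0) (f 0); rewrite subrK => h6.
    rewrite subr0 in h3; rewrite -/p in h5.
    rewrite /T; lra.
have psii : rho.-integrable setT (EFin \o psi).
  by apply: integrable_pushforward => //; exact/measurable_EFinP.
have psiE : \int[rho]_y psi y = \int[mu]_x psi (T x).
  by rewrite -(@Rintegral_image R _ _ _ _ mu rho T).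
have Cnu : (Ccost nu rho <= (\int[nu]_x f x + \int[rho]_y psi y)%:E)%E.
  (* The conjugate may be infinite, but it is finite on the range of [T], so this set has full
     [rho]-measure and taking [fine] loses nothing there. *)
  pose S := [set y : Rd R n | conjugate f y \is a fin_num].
  have mS : measurable S.
    have := emeasurable_fin_num measurableT (measurable_conjugate f).
    by rewrite setTI.
  apply: (Ccost_le_potentials nu1 rho_uball mS) => //.
  - by apply: rho_null => x; rewrite /S/= conjT.
  - exact: fi.
  - by move=> x y yS; exact: dotp_le_conjugate.
(* The coupling carried by the graph of [T] is tested: [dotp x (T x)] is at least
   [dotp p (T x) = f p + psi (T x)] for [p = prox x], and [f p >= f x - lam]. This is the only
   loss. *)
have Cmu : ((\int[mu]_x f x + \int[rho]_y psi y - lam)%:E <= Ccost mu rho)%E.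
  apply: le_trans (le_Ccost mu1 rho_uball cpi); rewrite lee_fin.
  have di := integrable_coupling_dotp cpi mu1 rho_uball.
  rewrite -(@Rintegral_image R _ _ _ _ mu pi (fun x => (x, T x)))//.
  have di' := @integrable_image R _ _ _ _ mu pi (fun x => (x, T x)) mgr
    (fun _ _ => erefl) _ di.
  rewrite psiE -(RintegralD _ (fi _ mu1) psiT)// -[X in _ - X](Rintegral_prob_cst mu).
  rewrite -RintegralB//; last 2 first.
  - exact: (integrableD_EFin (fi _ mu1) psiT).
  - exact: finite_measure_integrable_cst.
  apply: le_Rintegral => //.
    apply: (integrableD_EFin (integrableD_EFin (fi _ mu1) psiT)).
    exact: finite_measure_integrable_cst.
  move=> x _; rewrite /psi conjT/=.
  have h1 : f x - f (prox f lam x) <= lam.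
    have [_ /(_ x (prox f lam x))] := fC; rewrite ler_norml => /andP[_ h].
    exact: le_trans h (xp x).
  have h2 : dotp (prox f lam x) (T x : 'rV[R]_n) <= dotp (x : 'rV[R]_n) (T x).
    rewrite [leRHS](_ : _ = dotp (prox f lam x) (T x : 'rV[R]_n) +
      lam * dotp (T x : 'rV[R]_n) (T x)); last first.
      by rewrite -dotpZl -dotpDl -(sgradE f l0 x).
    by rewrite lerDl mulr_ge0 ?(ltW l0)//; exact: dotpxx_ge0.
  lra.
apply: le_trans (leeB Cnu Cmu) _; rewrite -EFinB lee_fin; lra.
Qed.

End potential_to_transport.

Theorem theorem1 (R : realType) (n : nat) (mu nu : probability (Rd R n) R) :
  finite_first_moment mu -> finite_first_moment nu ->
  ereal_inf [set v | exists f : 'rV[R]_n -> R, convex_1lip f /\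
      v = (\int[nu]_x (f x)%:E - \int[mu]_x (f x)%:E)%E]
  = ereal_inf [set v | exists rho : probability (Rd R n) R, P1 rho /\
      v = (Ccost nu rho - Ccost mu rho)%E].
Proof.
move=> mu1 nu1.
have intE f : convex_1lip f -> (\int[nu]_x (f x)%:E - \int[mu]_x (f x)%:E)%E =
    (\int[nu]_(x in [set: Rd R n]) f x - \int[mu]_(x in [set: Rd R n]) f x)%:E.
  by move=> [_ fl]; rewrite !EFin_Rintegral//; exact: lip_integrable.
(* Each target provides a potential for [<=] and each potential a target for [>=], in both cases up
   to an arbitrary positive error. *)
apply/eqP; rewrite eq_le; apply/andP; split.
  apply: le_ereal_inf_tmp => _ [rho [rho1 ->]]; apply/lee_addgt0Pr => e e0.
  have [f [fC fle]] := exists_potential mu1 nu1 (P1_uball rho1) e0.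
  apply: le_trans fle; apply: ereal_inf_lbound; exists f; split => //.
  by rewrite intE.
apply: le_ereal_inf_tmp => _ [f [fC ->]]; apply/lee_addgt0Pr => e e0.
have [rho [rho1 rle]] := exists_target mu1 nu1 fC e0.
rewrite intE// -EFinD; apply: le_trans rle.
by apply: ereal_inf_lbound; exists rho.
Qed.
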